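(* Let $I=(i_1,\dots,i_k)$ and $J=(j_1,\dots,j_k)$ be sequences of distinct positive integers, so that $(I,J)$ is a partial permutation of $[n]$ of size $k$ for every $n\ge\max(I),\max(J)$. Then there are polynomials $\{c_\lambda(n):|\lambda|\le k\}$ in $n$, indexed by partitions $\lambda$ with $|\lambda|\le k$, with $\deg c_\lambda(n)\le k-|\lambda|$, such that for all $n\ge \max(I),\max(J),2k$, \[ A_{n,I,J} \;=\;(n-\#(I\cup J))!\times\sum_{|\lambda|\le k}c_\lambda(n)\, s_{\lambda[n]}. \]
   Context: For a partial permutation $(I,J)$ of $[n]$ (sequences $I,J$ of the same length with distinct entries in $[n]$), let $\mathbf 1_{I,J}:\mathfrak S_n\to\mathbb C$ be the indicator of $\{w: w(i_p)=j_p \ \forall p\}$. The Reynolds operator is $(Rf)(w)=\frac1{n!}\sum_{v\in\mathfrak S_n}f(v^{-1}wv)$, and the Frobenius characteristic of a class function is $\mathrm{ch}_n(f)=\frac1{n!}\sum_{w\in\mathfrak S_n}f(w)p_{\mathrm{cyc}(w)}$ (with $\mathrm{cyc}(w)$ the cycle type and $p_\lambda$ the power sum symmetric function). The atomic symmetric function is $A_{n,I,J}:=n!\cdot\mathrm{ch}_n(R\,\mathbf 1_{I,J})$. $I\cup J$ denotes the set of entries appearing in $I$ or $J$. For a partition $\lambda$ and $n\ge|\lambda|+\lambda_1$, $\lambda[n]:=(n-|\lambda|,\lambda_1,\lambda_2,\dots)\vdash n$; $s_\lambda$ is the Schur function. *)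

(* Defs.v *)
From HB Require Import structures.
From mathcomp Require Import all_boot all_order all_fingroup all_algebra.
From mathcomp Require Import mpoly.

Set Implicit Arguments.
Unset Strict Implicit.
Unset Printing Implicit Defensive.

Import GRing.Theory.
Local Open Scope ring_scope.

(** A symmetric function is represented by its restrictions to finitely many
    variables x_0, ..., x_(m-1), for all m.  The ring Lambda of symmetric
    functions is the graded inverse limit of the rings of symmetric polynomials,
    so it is a subring of this product of polynomial rings, with componentwise
    operations: two symmetric functions are equal iff they agree for every m. *)
Definition symfun (C : fieldType) := forall m : nat, {mpoly C[m]}.

(** Partitions are weakly decreasing sequences of positive integers. *)
Definition is_part (la : seq nat) : bool := sorted geq la && (0%N \notin la).

(** All partitions la with |la| <= k, each listed once: see [mem_parts_le] and
    [parts_le_uniq].  Such a partition has at most k parts, all at most k. *)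
Definition parts_le (k : nat) : seq (seq nat) :=
  [seq la <- [seq map val (s : seq 'I_k.+1) | s : k.-bseq 'I_k.+1]
     | is_part la && (sumn la <= k)%N].

Lemma parts_le_uniq k : uniq (parts_le k).
Proof.
apply/filter_uniq; rewrite map_inj_uniq ?enum_uniq // => s t.
by move/(inj_map val_inj)/val_inj.
Qed.

Lemma mem_parts_le k la :
  (la \in parts_le k) = is_part la && (sumn la <= k)%N.
Proof.
rewrite mem_filter; case: (boolP (is_part la && _)) => //= /andP[/andP[_ la0] le_k].
have le_elt x : x \in la -> (x <= k)%N.
  move=> xla; apply: leq_trans le_k; elim: la xla {la0} => //= y la IH.
  by rewrite inE => /predU1P[->|/IH le]; rewrite ?leq_addr ?(leq_trans le) ?leq_addl.
have le_size : (size la <= k)%N.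
  apply: leq_trans le_k; elim: la la0 {le_elt} => //= y la IH.
  rewrite inE negb_or eq_sym -lt0n => /andP[y0 /IH le].
  by rewrite -add1n leq_add.
have le_size' : (size [seq inord x : 'I_k.+1 | x <- la] <= k)%N by rewrite size_map.
apply/imageP; exists (Bseq le_size') => //=.
rewrite -map_comp -[LHS]map_id; apply/eq_in_map => x /le_elt le_xk /=.
by rewrite inordK.
Qed.

(** la[n] = (n - |la|, la_1, la_2, ...).  For n = 0 the only part is 0, which
    contributes no cell to the diagram. *)
Definition padded (la : seq nat) (n : nat) : seq nat := (n - sumn la)%N :: la.

(** A cell of the Young diagram of la (English notation) is a pair (row, column). *)
Definition cell (la : seq nat) : finType :=
  {r : 'I_(size la) & 'I_(nth 0%N la r)}.

Definition cell_row (la : seq nat) (c : cell la) : nat := tag c.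
Definition cell_col (la : seq nat) (c : cell la) : nat := tagged c.

Definition semistandard (la : seq nat) (m : nat) (T : {ffun cell la -> 'I_m}) : bool :=
  [forall c : cell la, forall d : cell la,
     ((cell_row c == cell_row d) && (cell_col c < cell_col d) ==> (T c <= T d))
  && ((cell_col c == cell_col d) && (cell_row c < cell_row d) ==> (T c < T d))]%N.

Definition schur (C : fieldType) (la : seq nat) : symfun C := fun m =>
  \sum_(T : {ffun cell la -> 'I_m} | semistandard T) \prod_(c : cell la) 'X_(T c).

Definition power_sum (C : fieldType) (la : seq nat) : symfun C := fun m =>
  \prod_(d <- la) \sum_(i < m) 'X_i ^+ d.

Definition cycle_type (n : nat) (w : 'S_n) : seq nat :=
  sort geq [seq #|B| | B : {set 'I_n} <- enum (porbits w)].

Definition reynolds (C : fieldType) (n : nat) (f : 'S_n -> C) : 'S_n -> C :=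
  fun w => n`!%:R^-1 * \sum_(v : 'S_n) f (v^-1 * w * v)%g.

Definition frob_ch (C : fieldType) (n : nat) (f : 'S_n -> C) : symfun C := fun m =>
  n`!%:R^-1 *: \sum_(w : 'S_n) f w *: power_sum C (cycle_type w) m.

(** The element i of [n] = {1, ..., n} corresponds to the ordinal i - 1 : 'I_n. *)
Definition pperm_ind (C : fieldType) (n k : nat) (I J : k.-tuple nat) :
    'S_n -> C :=
  fun w => [forall p : 'I_k, exists x : 'I_n,
              (x.+1 == tnth I p) && ((w x).+1 == tnth J p)]%:R.

Definition atomic (C : fieldType) (n k : nat) (I J : k.-tuple nat) : symfun C :=
  fun m => n`!%:R *: frob_ch (reynolds (@pperm_ind C n k I J)) m.

(* Main.v *)
(* Since p_(cyc w) depends only on the conjugacy class of w, A_(n,I,J) is the sum of p_(cyc w)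
   over the permutations w extending the partial permutation (I,J).  View (I,J) as a graph with
   vertex set I u J, and let i -> j be an edge such that j is the end of a path.  Remove this
   edge and sort the extensions w of the rest by the value w(i): all values outside the remaining
   vertices contribute A_(n,I,J), by conjugation, and each of the others gives a partial
   permutation of the same size with one vertex less.  This recursion on the number of vertices
   respects the bound on degrees and ends with disjoint unions of cycles, for which
   A_(n,I,J) = (n-k)! p_nu h_(n-k).  By Newton's identities and Pieri's rule p_nu is a combination
   of the s_mu with |mu| = k, and one more use of Pieri's rule gives
   s_mu h_(n-k) = sum of s_(ka[n]) over the ka interlacing mu, as soon as n >= 2k. *)

Require Import Defs.
From mathcomp Require Import all_boot all_order all_fingroup all_algebra.
From mathcomp Require Import mpoly zify ring.

Set Implicit Arguments.
Unset Strict Implicit.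
Unset Printing Implicit Defensive.

Import GRing.Theory.
Local Open Scope ring_scope.

(** * Interlacing sequences, Pieri's rule and Newton's identities *)

(** The length is that of [hi]; a surplus entry of [lo] is ignored, which matters for [interl
    [::]]. *)
Fixpoint box (lo hi : seq nat) : seq (seq nat) :=
  if hi is b :: hi' then
    if lo is a :: lo' then
      [seq x :: t | x <- iota a (b.+1 - a), t <- box lo' hi']
    else [::]
  else [:: [::]].

Fixpoint inbox (lo hi t : seq nat) : bool :=
  match hi, lo, t with
  | b :: hi', a :: lo', x :: t' => (a <= x <= b)%N && inbox lo' hi' t'
  | [::], _, [::] => true
  | _, _, _ => false
  end.

Lemma mem_box lo hi t : (t \in box lo hi) = inbox lo hi t.
Proof.
elim: hi lo t => [|b hi IH] [|a lo] [|x t] //=.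
  by apply/allpairsP => -[[y u] /= [_ _]].
rewrite -IH; apply/allpairsP/idP => [[[y u] /= [ha hb [-> ->]]]|].
  by rewrite hb andbT; move: ha; rewrite mem_iota; lia.
by case/andP => h1 h2; exists (x, t); split => //=; rewrite mem_iota; lia.
Qed.

Lemma box_uniq lo hi : uniq (box lo hi).
Proof.
elim: hi lo => [|b hi IH] [|a lo] //=.
by apply: allpairs_uniq; rewrite ?iota_uniq // => -[? ?] [? ?] _ _ [-> ->].
Qed.

Lemma inbox_size lo hi t : inbox lo hi t -> size t = size hi.
Proof. by elim: hi lo t => [|b hi IH] [|a lo] [|x t] //= /andP[_ /IH ->]. Qed.

Lemma inbox_sumn lo hi t : inbox lo hi t -> (sumn t <= sumn hi)%N.
Proof. by elim: hi lo t => [|b hi IH] [|a lo] [|x t] //= /andP[? /IH]; lia. Qed.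

(** For weakly decreasing [la] these are the [ka] such that [la / ka] is a horizontal strip, written
    with as many entries as [la]. *)
Definition interl (la : seq nat) := box (rcons (behead la) 0%N) la.

Definition interlaces (la ka : seq nat) := inbox (rcons (behead la) 0%N) la ka.

Lemma mem_interl la ka : (ka \in interl la) = interlaces la ka.
Proof. exact: mem_box. Qed.

Lemma interlaces_cons a la b ka :
  interlaces (a :: la) (b :: ka) = (head 0%N la <= b <= a)%N && interlaces la ka.
Proof. by case: la => [|c la] //=; case: ka. Qed.

(** Solved for [ka] instead of [rh], the interlacing inequalities again describe a box, once [b]
    bounds the first entry of [ka]. *)
Lemma interlaces_dual ka b rh :
  interlaces ka rh && (head 0%N ka <= b)%N = inbox rh (belast b rh) ka.
Proof.
elim: ka b rh => [|c ka IH] b [|d rh] //; first by rewrite /interlaces; case: ka {IH}.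
by rewrite interlaces_cons /= -IH; lia.
Qed.

Lemma interlaces_size la ka : interlaces la ka -> size ka = size la.
Proof. exact: inbox_size. Qed.

Lemma interlaces_sumn la ka : interlaces la ka -> (sumn ka <= sumn la)%N.
Proof. exact: inbox_sumn. Qed.

Lemma interlaces_head la ka : interlaces la ka -> (head 0 ka <= head 0 la)%N.
Proof. by case: la ka => [|a la] [|b ka] //; rewrite interlaces_cons /=; lia. Qed.

Lemma interlaces_sorted la ka : interlaces la ka -> sorted geq ka.
Proof.
elim: la ka => [|a la IH] [|b ka] //; rewrite interlaces_cons => /andP[hb hk].
have := IH _ hk; have := interlaces_head hk.
by case: ka {hk} => [|c ka] //= h ->; rewrite andbT; lia.
Qed.

Definition zipmax (s t : seq nat) := [seq maxn p.1 p.2 | p <- zip s t].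
Definition zipmin (s t : seq nat) := [seq minn p.1 p.2 | p <- zip s t].

Lemma inbox_inter lo1 hi1 lo2 hi2 t :
  size hi1 = size hi2 ->
  inbox lo1 hi1 t && inbox lo2 hi2 t = inbox (zipmax lo1 lo2) (zipmin hi1 hi2) t.
Proof.
elim: hi1 lo1 hi2 lo2 t => [|b hi1 IH] lo1 [|b2 hi2] lo2 [|x t] // sz;
  case: lo1 => [|a lo1]; case: lo2 => [|a2 lo2] //=; rewrite ?andbF //.
by rewrite -/(zipmax lo1 lo2) -/(zipmin hi1 hi2) -IH; [lia | case: sz].
Qed.

Section Generic.
Variable (R : comNzRingType).

(** Reflecting every coordinate in the midpoint of its interval maps the box onto itself. *)
Lemma sum_box_rev (F : nat -> R) lo hi : size lo = size hi ->
  \sum_(t <- box lo hi) F (sumn t)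
  = \sum_(t <- box lo hi) F (sumn lo + sumn hi - sumn t)%N.
Proof.
have rev1 (G : nat -> R) a b :
    \sum_(x <- iota a (b.+1 - a)) G x
    = \sum_(x <- iota a (b.+1 - a)) G (a + b - x)%N.
  rewrite -/(index_iota a b.+1) big_nat_rev /=.
  by apply: eq_bigr => i _; rewrite addnS subSS.
elim: hi lo F => [|b hi IH] [|a lo] F //= sz; rewrite ?big_seq1 //.
rewrite !big_allpairs_dep /=.
under eq_bigr => y _ do rewrite (IH lo (fun z => F (y + z)%N)) ?(succn_inj sz) //.
rewrite exchange_big [RHS]exchange_big /=; apply: eq_big_seq => t.
rewrite mem_box => /inbox_sumn ht.
rewrite (rev1 (fun y => F (y + (sumn lo + sumn hi - sumn t))%N)).
apply: eq_big_seq => y; rewrite mem_iota => hy.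
by congr F; lia.
Qed.

(** Replaces a range that depends on an outer variable by a fixed larger one, so that sums can be
    exchanged. *)
Lemma sum_box_sub (G : seq nat -> R) lo hi lo' hi' :
  {subset box lo hi <= box lo' hi'} ->
  \sum_(t <- box lo hi) G t = \sum_(t <- box lo' hi' | t \in box lo hi) G t.
Proof.
move=> sub; rewrite -[RHS]big_filter; apply: perm_big; apply: uniq_perm.
- exact: box_uniq.
- by apply: filter_uniq; apply: box_uniq.
by move=> t; rewrite mem_filter; case: (boolP (t \in box lo hi)) => //= /sub ->.
Qed.

Lemma sum_box_inter (G : seq nat -> R) lo1 hi1 lo2 hi2 :
  size hi1 = size hi2 ->
  \sum_(t <- box lo1 hi1 | inbox lo2 hi2 t) G t
  = \sum_(t <- box (zipmax lo1 lo2) (zipmin hi1 hi2)) G t.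
Proof.
move=> sz; rewrite -[LHS]big_filter; apply: perm_big; apply: uniq_perm.
- by apply: filter_uniq; apply: box_uniq.
- exact: box_uniq.
by move=> t; rewrite mem_filter !mem_box andbC inbox_inter.
Qed.

(** The maxima and minima are those of the same pairs, shifted by one place, so that max + min = sum
    applies. Only the maximum of [head 0 la] and [b] is missing; the minimum with the final 0
    vanishes. This locates the center of the reflection used in [pieri]. *)
Lemma sumn_zipmax_zipmin la b rh : size rh = size la ->
  (sumn (zipmax (rcons (behead la) 0) rh) + sumn (zipmin la (belast b rh))
   + maxn (head 0 la) b = sumn la + sumn rh + b)%N.
Proof.
elim: la b rh => [|a la IH] b [|c rh] //=; first by rewrite max0n.
case=> sz; have {}IH := IH c _ sz.
have -> : zipmax (rcons la 0%N) (c :: rh)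
    = maxn (head 0%N la) c :: zipmax (rcons (behead la) 0%N) rh.
  by case: la sz {IH} => [|d la] //=; case: rh.
rewrite /= -/(zipmin la (belast c rh)); lia.
Qed.

Lemma eq_big_bij (A B : eqType) (s : seq A) (t : seq B) (f : A -> B) (g : B -> A)
    (P : pred A) (Q : pred B) (F : B -> R) :
  uniq s -> uniq t ->
  (forall a, a \in s -> P a -> [/\ f a \in t, Q (f a) & g (f a) = a]) ->
  (forall b, b \in t -> Q b -> [/\ g b \in s, P (g b) & f (g b) = b]) ->
  \sum_(a <- s | P a) F (f a) = \sum_(b <- t | Q b) F b.
Proof.
move=> us ut hf hg; rewrite -[LHS]big_filter -[RHS]big_filter.
rewrite -(big_map f predT F); apply: perm_big; apply: uniq_perm.
- rewrite map_inj_in_uniq ?filter_uniq // => a b.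
  rewrite !mem_filter => /andP[pa sa] /andP[pb sb] e.
  by have [_ _ <-] := hf a sa pa; have [_ _ <-] := hf b sb pb; rewrite e.
- exact: filter_uniq.
move=> b; apply/mapP/idP => [[a]|].
  by rewrite !mem_filter => /andP[pa sa] ->; have [-> -> _] := hf a sa pa.
rewrite mem_filter => /andP[qb tb]; have [sg pg e] := hg b tb qb.
by exists (g b); rewrite ?mem_filter ?pg ?sg.
Qed.

Lemma interl_cons a ka :
  interl (a :: ka)
  = [seq y :: t | y <- iota (head 0%N ka) (a.+1 - head 0%N ka), t <- interl ka].
Proof. by rewrite /interl; case: ka. Qed.

Lemma interl_rcons0 la : interl (rcons la 0%N) = [seq rcons t 0%N | t <- interl la].
Proof.
elim: la => [|a la IH] //=; rewrite !interl_cons IH.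
have -> : head 0%N (rcons la 0%N) = head 0%N la by case: la {IH}.
rewrite allpairs_mapr map_allpairs; exact: eq_allpairs.
Qed.

(** * Schur polynomials in finitely many variables *)

Section Vars.
Variable x : nat -> R.

(* The Schur polynomial in the variables x_0, ..., x_(m-1), by the branching rule. *)
Fixpoint schur_poly (m : nat) (la : seq nat) : R :=
  if m is m'.+1 then
    \sum_(ka <- interl la) schur_poly m' ka * x m' ^+ (sumn la - sumn ka)
  else (sumn la == 0%N)%:R.

(** One-row shapes give the complete homogeneous polynomials h_r, here expanded in powers of the
    last variable. *)
Lemma schur_poly1S m r :
  schur_poly m.+1 [:: r] = \sum_(j < r.+1) schur_poly m [:: (r - j)%N] * x m ^+ j.
Proof.
have e : interl [:: r] = [seq [:: y] | y <- index_iota 0 r.+1].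
  by rewrite /interl /index_iota subn0 /=; congr (_ :: _); elim: (iota _ _) => //= a s ->.
rewrite [LHS]/= e big_map big_mkord (reindex_inj rev_ord_inj) /=.
apply: eq_bigr => j _; rewrite /= !addn0 subSS.
by congr (_ * x m ^+ _); have := ltn_ord j; lia.
Qed.

Lemma interl_sum0 la : sumn la = 0%N -> interl la = [:: la].
Proof.
move=> h; have {h} -> : la = nseq (size la) 0%N.
  by elim: la h => [|a la IH] //= h; rewrite -IH; [congr (_ :: _)|]; lia.
case: (size la) => // n.
have e : rcons (nseq n 0%N) 0%N = 0%N :: nseq n 0%N.
  by elim: n => //= n ->.
rewrite /interl /= e; elim: n {e} => [|n IH] //=.
by rewrite /= in IH; rewrite IH.
Qed.

(* The horizontal strips added to [la] are the sequences [a :: ka] with [ka] interlacing [la]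
   and [a] at least the first part of [la].  Expand both sides by the branching rule: the
   coefficients of [schur_poly m (b :: rh)] count the same box of sequences [ka], subject to a
   lower bound on [sumn ka] on the left and to an upper bound on the right, and the reversal of
   the box exchanges the two conditions. *)
Lemma pieri m la r :
  schur_poly m la * schur_poly m [:: r]
  = \sum_(ka <- interl la | (head 0 la + sumn ka <= sumn la + r)%N)
      schur_poly m ((sumn la + r - sumn ka)%N :: ka).
Proof.
elim: m la r => [|m IH] la r.
  rewrite /= addn0 -natrM mulnb.
  case: (boolP (_ && _)) => [/andP[/eqP h0 /eqP ->]|h].
    rewrite interl_sum0 // big_mkcond big_seq1 h0 !addn0.
    suff -> : head 0%N la = 0%N by rewrite /= ?h0 ?eqxx.
    by case: la h0 => //= a la; lia.
  rewrite big_seq_cond big1 // => ka /andP[]; rewrite mem_interl => /interlaces_sumn hk _.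
  by rewrite (_ : _ == 0%N = false) //; lia.
(* [B] is the total degree. In both expansions the summands are the terms [T b rh], where [x m]
   takes the degree that [b :: rh] leaves over. *)
pose B := (sumn la + r)%N.
pose T b rh := x m ^+ (B - b - sumn rh) * schur_poly m (b :: rh).
pose L := size la.
pose ALL := box (nseq L 0%N) (nseq L B).
have subALL ka : (sumn ka <= B)%N -> size ka = L -> {subset interl ka <= ALL}.
  move=> hs hL rh; rewrite mem_interl /ALL mem_box -hL /interlaces.
  elim: ka (rcons _ _) rh hs {hL} => [|a ka IHk] [|d lo] [|e rh] //= hs /andP[h1 h2].
  rewrite (IHk lo) ?andbT //; lia.
pose lo rh := zipmax (rcons (behead la) 0%N) rh.
pose hi b rh := zipmin la (belast b rh).
(* For fixed [rh] and [b] the admissible [ka] form an intersection of two boxes, and the two sides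
   differ only in the condition [D] on [sumn ka]. The fixed list [ALL] lets the sum over [rh] move
   outside. *)
have NF (D : nat -> seq nat -> pred nat) :
    \sum_(ka <- interl la) \sum_(rh <- interl ka)
      \sum_(0 <= b < B.+1 | (head 0 ka <= b)%N && D (sumn ka) rh b) T b rh
    = \sum_(rh <- ALL | size rh == L) \sum_(0 <= b < B.+1)
        \sum_(ka <- box (lo rh) (hi b rh)) (if D (sumn ka) rh b then T b rh else 0).
  transitivity (\sum_(rh <- ALL | size rh == L) \sum_(ka <- interl la | interlaces ka rh)
      \sum_(0 <= b < B.+1 | (head 0 ka <= b)%N && D (sumn ka) rh b) T b rh).
    rewrite (exchange_big_dep predT) //= !big_seq; apply: eq_bigr => ka.
    rewrite mem_interl => hk.
    have hs := interlaces_size hk; have hk' := interlaces_sumn hk.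
    rewrite (sum_box_sub _ (lo' := nseq L 0%N) (hi' := nseq L B)); last first.
      by apply: subALL => //; rewrite /B; lia.
    apply: eq_bigl => rh; rewrite -/(interl ka) mem_interl.
    by case: (boolP (interlaces ka rh)) => [/interlaces_size ->|]; rewrite ?andbF // hs eqxx.
  apply: eq_bigr => rh /eqP sz.
  rewrite (exchange_big_dep predT) //=; apply: eq_bigr => b _.
  rewrite -sum_box_inter; last by rewrite size_belast sz.
  rewrite [RHS]big_mkcond [LHS]big_mkcond /=; apply: eq_bigr => ka _.
  rewrite -interlaces_dual.
  by case: (interlaces ka rh); case: (_ <= _)%N; case: (D _ _ _).
(* Left side: [j] is replaced by [b = sumn ka + (r - j) - sumn rh], the first part produced by the
   induction hypothesis. The bound [0 <= j] becomes the upper bound on [b]. *)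
transitivity (\sum_(ka <- interl la) \sum_(rh <- interl ka)
      \sum_(0 <= b < B.+1 | (head 0 ka <= b)%N && (b + sumn rh <= sumn ka + r)%N) T b rh).
  rewrite schur_poly1S [schur_poly m.+1 la]/= mulr_suml; apply: eq_big_seq => ka.
  rewrite mem_interl => /interlaces_sumn hk.
  rewrite mulr_sumr.
  under eq_bigr => j _.
    rewrite mulrACA IH mulr_suml -exprD big_mkcond /=; over.
  rewrite exchange_big /=; apply: eq_big_seq => rh.
  rewrite mem_interl => hr; have hr' := interlaces_sumn hr.
  (* This is [j <= r] in terms of [b]; it is automatic because the interlacing bounds [ka] entrywise
     by [b :: rh]. *)
  have hb b : (head 0 ka <= b -> sumn ka <= b + sumn rh)%N.
    move=> hb; have := interlaces_dual ka b rh; rewrite hr hb => /esym/inbox_sumn.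
    suff : (sumn (belast b rh) <= b + sumn rh)%N by lia.
    by elim: (rh) b {hb} => //= c s IHs b; have := IHs c; lia.
  have hb0 := hb _ (leqnn _).
  rewrite -big_mkcond /= -(big_mkord (fun j => head 0 ka + sumn rh <= sumn ka + (r - j))%N
    (fun j => schur_poly m ((sumn ka + (r - j) - sumn rh)%N :: rh)
              * x m ^+ (sumn la - sumn ka + j))).
  rewrite -(@eq_big_bij _ _ (index_iota 0 r.+1) (index_iota 0 B.+1)
     (fun j => (sumn ka + (r - j) - sumn rh)%N) (fun b => (sumn ka + r - sumn rh - b)%N)
     (fun j => head 0 ka + sumn rh <= sumn ka + (r - j))%N); rewrite ?iota_uniq //.
  - rewrite big_seq_cond [RHS]big_seq_cond; apply: eq_bigr => j.
    rewrite mem_index_iota /T mulrC => hj.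
    congr (x m ^+ _ * _); rewrite /B; lia.
  - by move=> j; rewrite !mem_index_iota /B; split; lia.
  - by move=> b; rewrite !mem_index_iota /B => h1 /andP[h4 h3]; have h2 := hb _ h4; split; lia.
(* Right side: [b] is the first entry of a sequence interlacing [(B - sumn ka) :: ka], hence at most
   [B - sumn ka]. *)
transitivity (\sum_(ka <- interl la) \sum_(rh <- interl ka)
      \sum_(0 <= b < B.+1 | (head 0 ka <= b)%N
             && ((head 0 la + sumn ka <= B) && (b + sumn ka <= B))%N) T b rh); last first.
  rewrite [RHS]big_mkcond /=; apply: eq_big_seq => ka.
  rewrite mem_interl => /interlaces_sumn hk.
  case: leqP => hc; last first.
    by apply: big1 => rh _; apply: big1 => b; rewrite andbF.
  rewrite -/B /= interl_cons big_allpairs_dep [RHS]exchange_big /=; apply: eq_bigr => rh _.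
  rewrite -[LHS]big_filter; rewrite -/(index_iota _ _).
  rewrite (perm_big (index_iota (head 0 ka) (B - sumn ka).+1)%N).
    rewrite !big_seq; apply: eq_bigr => b; rewrite mem_index_iota /T mulrC => hj.
    congr (_ * x m ^+ _); rewrite /B in hc hj *; lia.
  apply: uniq_perm => [||b]; [exact/filter_uniq/iota_uniq | exact: iota_uniq |].
  by rewrite mem_filter !mem_index_iota /B; apply/idP/idP; rewrite /B in hc *; lia.
rewrite (NF (fun k rh b => b + sumn rh <= k + r)%N).
rewrite (NF (fun k _ b => (head 0 la + k <= B) && (b + k <= B))%N).
apply: eq_bigr => rh /eqP sz; apply: eq_bigr => b _.
have szlo : size (lo rh) = size (hi b rh).
  rewrite /lo /hi /zipmax /zipmin !size_map !size_zip size_belast size_rcons size_behead sz.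
  by rewrite /L; case: (la) => //= *; rewrite !minnn.
(* The reflection turns the left condition into [maxn (head 0 la) b + sumn ka <= B], which is the
   conjunction on the right. *)
rewrite (@sum_box_rev (fun y => if (b + sumn rh <= y + r)%N then T b rh else 0)) //.
apply: eq_big_seq => ka; rewrite mem_box => /inbox_sumn hk.
have := sumn_zipmax_zipmin b sz; rewrite -/(lo rh) -/(hi b rh) => e.
by congr (if _ then _ else _); rewrite /B; lia.
Qed.

(** Interlacing preserves the length, so partitions acquire trailing zeros; these are harmless. *)
Lemma schur_poly_rcons0 m la : schur_poly m (rcons la 0%N) = schur_poly m la.
Proof.
elim: m la => [|m IH] la /=; first by rewrite sumn_rcons addn0.
rewrite interl_rcons0 big_map; apply: eq_bigr => ka _.
by rewrite IH !sumn_rcons !addn0.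
Qed.

Lemma schur_poly_cat0 m la j : schur_poly m (la ++ nseq j 0%N) = schur_poly m la.
Proof.
elim: j la => [|j IH] la; first by rewrite cats0.
by rewrite -cat_rcons IH schur_poly_rcons0.
Qed.

Arguments schur_poly : simpl never.

Lemma schur_poly1_0 m : schur_poly m [:: 0%N] = 1.
Proof. by elim: m => [|m IH] //; rewrite schur_poly1S big_ord1 IH mulr1. Qed.

(** Separates the monomials of h_(r+1) that are divisible by the last variable. *)
Lemma schur_poly1_rec m r :
  schur_poly m.+1 [:: r.+1] = schur_poly m [:: r.+1] + x m * schur_poly m.+1 [:: r].
Proof.
rewrite !schur_poly1S big_ord_recl subn0 mulr1 mulr_sumr; congr (_ + _).
by apply: eq_bigr => j _; rewrite exprS mulrCA.
Qed.

Definition psum (m r : nat) : R := \sum_(i < m) x i ^+ r.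

(** Newton's identities between power sums and complete homogeneous polynomials, by induction on the
    number of variables and then on [r]. *)
Lemma newton m r :
  \sum_(i < r) psum m i.+1 * schur_poly m [:: (r - i.+1)%N] = r%:R * schur_poly m [:: r].
Proof.
elim: m r => [|m IHm] r.
  rewrite big1 => [|i _]; last by rewrite /psum big_ord0 mul0r.
  by case: r => [|r]; rewrite ?mul0r // /schur_poly /= mulr0.
elim: r => [|r IHr]; first by rewrite big_ord0 mul0r.
have psumS i : psum m.+1 i = psum m i + x m ^+ i by rewrite /psum big_ord_recr.
under eq_bigr => i _ do rewrite psumS mulrDl subSS.
(* In the terms with [psum m i.+1], [schur_poly1_rec] lowers the number of variables, except at
   [i = r], where both polynomials are 1. The two sums multiplied by [x m] will combine to the
   identity for [r]. *)
have -> : \sum_(i < r.+1) (psum m i.+1 * schur_poly m.+1 [:: (r - i)%N]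
             + x m ^+ i.+1 * schur_poly m.+1 [:: (r - i)%N])
   = \sum_(i < r.+1) psum m i.+1 * schur_poly m [:: (r.+1 - i.+1)%N]
   + x m * \sum_(i < r) psum m i.+1 * schur_poly m.+1 [:: (r - i.+1)%N]
   + (x m * schur_poly m.+1 [:: r]
   + x m * \sum_(i < r) x m ^+ i.+1 * schur_poly m.+1 [:: (r - i.+1)%N]).
  rewrite big_split /=; congr (_ + _).
    rewrite !big_ord_recr /= subSS subnn !schur_poly1_0 addrAC; congr (_ + _).
    rewrite mulr_sumr -big_split /=; apply: eq_bigr => i _.
    have e : (r - i = (r - i.+1).+1)%N by have := ltn_ord i; lia.
    by rewrite subSS e schur_poly1_rec mulrDr mulrCA.
  rewrite big_ord_recl /= subn0 expr1; congr (_ + _).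
  by rewrite mulr_sumr; apply: eq_bigr => i _; rewrite mulrA -exprS.
move: IHr; under eq_bigr => i _ do rewrite psumS mulrDl.
rewrite big_split /= IHm schur_poly1_rec -natr1.
set a := \sum_(_ < _) _; set c := \sum_(_ < _) _ => e.
transitivity ((r%:R + 1) * schur_poly m [:: r.+1] + x m * (a + c) + x m * schur_poly m.+1 [:: r]).
  by ring.
by rewrite e; ring.
Qed.

End Vars.

End Generic.

(** * Schur polynomials and the branching rule *)

Lemma sorted_geq_nth la r r' :
  sorted geq la -> (r <= r')%N -> (nth 0 la r' <= nth 0 la r)%N.
Proof.
move=> sla hr; case: (ltnP r' (size la)) => h; last by rewrite nth_default.
have tr : transitive geq by move=> a b c /= h1 h2; apply: leq_trans h2 h1.
by apply: (sorted_leq_nth tr (leqnn : reflexive geq) 0%N sla) => //; rewrite inE; lia.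
Qed.

Lemma interlacesP la ka :
  reflect (size ka = size la /\
           forall r, (r < size la)%N -> (nth 0 la r.+1 <= nth 0 ka r <= nth 0 la r)%N)
          (interlaces la ka).
Proof.
elim: la ka => [|a la IH] [|b ka].
- by apply: ReflectT.
- by apply: ReflectF => -[].
- by rewrite /interlaces /=; case: la {IH} => [|c la]; apply: ReflectF => -[].
rewrite interlaces_cons; apply: (iffP andP) => [[h1 /IH[h2 h3]]|[[h1] h2]].
  by split=> [|[|r] hr] /=; [rewrite h2 | rewrite nth0 | apply: h3].
split; first by have := h2 0%N isT; rewrite /= nth0.
by apply/IH; split=> // r hr; apply: (h2 r.+1).
Qed.

(** As [t] is nondecreasing, the indices with value below [m] form an initial segment, so their
    number decides membership. *)
Lemma count_lt_monotone (t : nat -> nat) m L j :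
  (forall i i', (i < i' < L)%N -> (t i <= t i')%N) -> (j < L)%N ->
  (j < count (fun i => t i < m)%N (iota 0 L))%N = (t j < m)%N.
Proof.
elim: L => // L IH mono hj.
rewrite -[L.+1]addn1 iotaD count_cat /= add0n addn0.
have hc := count_size (fun i => t i < m)%N (iota 0 L); rewrite size_iota in hc.
case: (ltnP (t L) m) => htL /=.
  have -> : count (fun i => t i < m)%N (iota 0 L) = L.
    rewrite -[RHS](size_iota 0); apply/eqP; rewrite -all_count; apply/allP => i.
    by rewrite mem_iota => hi; apply: leq_ltn_trans htL; apply: mono; lia.
  rewrite addn1 hj; move: hj; rewrite ltnS leq_eqVlt => /orP[/eqP ->|hj]; first by rewrite htL.
  by apply/esym; apply: leq_ltn_trans htL; apply: mono; lia.
rewrite addn0; move: hj; rewrite ltnS leq_eqVlt => /orP[/eqP ->|hj]; first by lia.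
by apply: IH => // i i' hi; apply: mono; lia.
Qed.

Section Cells.
Variable la : seq nat.

Definition cellat (r j : nat) : option (cell la) :=
  obind (fun i : 'I_(size la) =>
    omap (fun k => Tagged (fun i : 'I_(size la) => 'I_(nth 0%N la i)) k)
      (insub j : option 'I_(nth 0%N la i)))
    (insub r).

Lemma cellatE (c : cell la) : cellat (cell_row c) (cell_col c) = Some c.
Proof. by case: c => i k; rewrite /cellat /cell_row /cell_col /= (valK i) /= (valK k). Qed.

Lemma cellat_in r j : (j < nth 0 la r)%N ->
  exists2 c : cell la, cell_row c = r & cell_col c = j.
Proof.
move=> hj; have hr : (r < size la)%N by rewrite ltnNge; apply: contraL hj => h; rewrite nth_default.
pose i := Ordinal hr; pose k : 'I_(nth 0%N la i) := Ordinal hj.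
by exists (Tagged (fun i : 'I_(size la) => 'I_(nth 0%N la i)) k).
Qed.

Lemma cell_col_lt (c : cell la) : (cell_col c < nth 0 la (cell_row c))%N.
Proof. by case: c => i k; apply: ltn_ord. Qed.

Variable M : nat.

(** Plain coordinates, with default 0 outside the diagram, avoid the dependent type of cells and
    make tableaux of different shapes comparable. *)
Definition entry (T : {ffun cell la -> 'I_M}) (r j : nat) : nat :=
  if cellat r j is Some c then T c else 0.

Lemma entryE T c : entry T (cell_row c) (cell_col c) = T c.
Proof. by rewrite /entry cellatE. Qed.

Lemma entry_lt T r j : (j < nth 0 la r)%N -> (entry T r j < M)%N.
Proof. by move=> /cellat_in[c <- <-]; rewrite entryE. Qed.

Lemma semistandardP (T : {ffun cell la -> 'I_M}) :
  reflect ((forall r j j', (j < j' < nth 0 la r)%N -> (entry T r j <= entry T r j')%N) /\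
           (forall r r' j, (r < r')%N -> (j < nth 0 la r)%N -> (j < nth 0 la r')%N ->
              (entry T r j < entry T r' j)%N))
          (semistandard T).
Proof.
apply: (iffP forallP) => [sst|[rows cols] c].
  split=> [r j j' /andP[hj hj']|r r' j hr hj hj'].
    have [c hc1 hc2] := cellat_in (ltn_trans hj hj'); have [d hd1 hd2] := cellat_in hj'.
    have /forallP/(_ d)/andP[/implyP h _] := sst c.
    by rewrite -hc2 -hd2 -{1}hc1 -hd1 !entryE; apply: h; rewrite hc1 hd1 eqxx hc2 hd2.
  have [c hc1 hc2] := cellat_in hj; have [d hd1 hd2] := cellat_in hj'.
  have /forallP/(_ d)/andP[_ /implyP h] := sst c.
  by rewrite -{1}hc2 -hd2 -hc1 -hd1 !entryE; apply: h; rewrite hc1 hd1 hc2 hd2 eqxx.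
apply/forallP => d; apply/andP; split; apply/implyP => /andP[/eqP e1 h].
  by have := rows _ _ _ (introT andP (conj h (cell_col_lt d))); rewrite -{1}e1 !entryE.
have := cols _ _ (cell_col c) h (cell_col_lt c); rewrite {1 3}e1 !entryE.
by apply; apply: cell_col_lt.
Qed.

Lemma prod_cell (R : comNzRingType) (x : nat -> R) (T : {ffun cell la -> 'I_M}) :
  \prod_(c : cell la) x (T c)
  = \prod_(0 <= r < size la) \prod_(0 <= j < nth 0 la r) x (entry T r j).
Proof.
rewrite big_mkord.
under [RHS]eq_bigr => r _ do rewrite big_mkord.
rewrite (@sig_big_dep _ _ _ _ (fun i : 'I_(size la) => 'I_(nth 0%N la i)) xpredT
  (fun _ _ => true) (fun r j => x (entry T r j))) /=.
by apply: eq_bigr => c _; rewrite -[X in x X]entryE.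
Qed.

End Cells.

Section Branching.
Variables (R : comNzRingType) (x : nat -> R) (M : nat).

(** The alphabet ['I_M] stays fixed while the bound [m] decreases, so the induction on [m] does not
    change the type of entries. *)
Definition tableau_sum (m : nat) (la : seq nat) : R :=
  \sum_(T : {ffun cell la -> 'I_M} | semistandard T && [forall c, T c < m]%N)
    \prod_(c : cell la) x (T c).

Definition subshape (m : nat) (la : seq nat) (T : {ffun cell la -> 'I_M}) : seq nat :=
  mkseq (fun r => count (fun j => entry T r j < m)%N (iota 0 (nth 0%N la r))) (size la).

Lemma subshapeP m la (T : {ffun cell la -> 'I_M}) ka :
  semistandard T -> size ka = size la -> (forall r, nth 0 ka r <= nth 0 la r)%N ->
  reflect (forall r j, (j < nth 0 la r)%N -> (j < nth 0 ka r)%N = (entry T r j < m)%N)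
          (subshape m T == ka).
Proof.
move=> /semistandardP[rows _] sz sub; apply: (iffP eqP) => [<- r j hj|h].
  rewrite nth_mkseq; first by apply: count_lt_monotone => // i i'; apply: rows.
  by rewrite ltnNge; apply: contraL hj => ?; rewrite nth_default.
apply: (@eq_from_nth _ 0%N); rewrite size_mkseq // => r hr; rewrite nth_mkseq //.
have := sub r; have := h r; move: (nth 0 ka r) (nth 0 la r) => k L {}h hk.
rewrite (@eq_in_count _ _ (fun j => j < k)%N) => [|j]; last first.
  by rewrite mem_iota => hj; rewrite h.
rewrite -(subnKC hk) iotaD count_cat add0n -[RHS]addn0; congr (_ + _)%N.
  rewrite -[RHS](size_iota 0); apply/eqP; rewrite -all_count; apply/allP => j.
  by rewrite mem_iota.
by apply/eqP; rewrite -leqn0 leqNgt -has_count; apply/hasPn => j; rewrite mem_iota; lia.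
Qed.

(** Columns increase strictly and no entry exceeds [m], so every cell with a cell below it has an
    entry less than [m]: row [r] keeps at least as many cells as row [r.+1] of [la] has. *)
Lemma subshape_interl m la (T : {ffun cell la -> 'I_M}) :
  sorted geq la -> semistandard T -> (forall c, T c < m.+1)%N ->
  subshape m T \in interl la.
Proof.
move=> sla ssT hT; rewrite mem_interl; apply/interlacesP; split; first exact: size_mkseq.
have /semistandardP[rows cols] := ssT.
move=> r hr; apply/andP; split; last first.
  by rewrite nth_mkseq // -[leqRHS](size_iota 0) count_size.
case e : (nth 0 la r.+1)%N => [|j] //.
have hj : (j < nth 0 la r.+1)%N by rewrite e.
have hj' : (j < nth 0 la r)%N by apply: leq_trans hj _; apply: sorted_geq_nth.
rewrite nth_mkseq // count_lt_monotone // => [|i i']; last exact: rows.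
apply: leq_trans (cols r r.+1 j _ hj' hj) _ => //.
by have [c <- <-] := cellat_in hj; rewrite entryE -ltnS.
Qed.

Section Fixed.
Variables (m : nat) (hm : (m < M)%N) (la ka : seq nat).
Hypotheses (sla : sorted geq la) (hk : interlaces la ka).

(** The default of [insubd] is never reached, because [ka] lies inside [la]. *)
Definition restrict_tab (T : {ffun cell la -> 'I_M}) : {ffun cell ka -> 'I_M} :=
  [ffun c => insubd (Ordinal hm) (entry T (cell_row c) (cell_col c))].

Definition extend_tab (T : {ffun cell ka -> 'I_M}) : {ffun cell la -> 'I_M} :=
  [ffun c => if (cell_col c < nth 0 ka (cell_row c))%N
             then insubd (Ordinal hm) (entry T (cell_row c) (cell_col c))
             else Ordinal hm].

Lemma sub_shape r : (nth 0 ka r <= nth 0 la r)%N.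
Proof.
have /interlacesP[sz h] := hk; case: (ltnP r (size la)) => hr; first by case/andP: (h r hr).
by rewrite nth_default // sz.
Qed.

Lemma entry_restrict T r j : (j < nth 0 ka r)%N -> entry (restrict_tab T) r j = entry T r j.
Proof.
move=> hj; have [c hc1 hc2] := cellat_in hj.
rewrite -{1}hc1 -{1}hc2 entryE ffunE hc1 hc2 val_insubd entry_lt //.
exact: leq_trans hj (sub_shape r).
Qed.

Lemma entry_extend T r j : (j < nth 0 la r)%N ->
  entry (extend_tab T) r j = if (j < nth 0 ka r)%N then entry T r j else m.
Proof.
move=> hj; have [c hc1 hc2] := cellat_in hj.
rewrite -{1}hc1 -{1}hc2 entryE ffunE hc1 hc2; case: ifP => // h.
by rewrite val_insubd entry_lt.
Qed.

Lemma eq_tab (mu : seq nat) (T T' : {ffun cell mu -> 'I_M}) :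
  (forall r j, (j < nth 0 mu r)%N -> entry T r j = entry T' r j) -> T = T'.
Proof.
move=> h; apply/ffunP => c; apply: val_inj; rewrite /= -!entryE.
exact/h/cell_col_lt.
Qed.

Lemma forall_entry (mu : seq nat) (T : {ffun cell mu -> 'I_M}) k :
  reflect (forall r j, (j < nth 0 mu r)%N -> (entry T r j < k)%N) [forall c, T c < k]%N.
Proof.
apply: (iffP forallP) => [h r j /cellat_in[c <- <-]|h c]; first by rewrite entryE.
by rewrite -entryE; apply/h/cell_col_lt.
Qed.

Lemma extend_restrict T :
  semistandard T -> [forall c, T c < m.+1]%N -> subshape m T == ka ->
  extend_tab (restrict_tab T) = T.
Proof.
move=> ssT /forall_entry hT /(subshapeP _ ssT) h.
have {}h := h (interlaces_size hk) sub_shape.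
apply: eq_tab => r j hj; rewrite entry_extend // h //; case: ltnP => h'.
  by rewrite entry_restrict // h.
by have := hT r j hj; lia.
Qed.

Lemma restrict_extend T : restrict_tab (extend_tab T) = T.
Proof.
apply: eq_tab => r j hj; rewrite entry_restrict // entry_extend ?hj //.
exact: leq_trans hj (sub_shape r).
Qed.

(** Filling the horizontal strip [la / ka] with [m] creates no violation, since the strip has at
    most one cell in each column. With the two cancellation lemmas this gives the bijection behind
    the branching rule. *)
Lemma semistandard_extend T :
  [&& semistandard (extend_tab T), [forall c, extend_tab T c < m.+1]%N
    & subshape m (extend_tab T) == ka]
  = semistandard T && [forall c, T c < m]%N.
Proof.
have lt_la r j : (j < nth 0 ka r -> j < nth 0 la r)%N.
  by move=> h; apply: leq_trans h (sub_shape r).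
apply/idP/idP => [/and3P[ssT _ /(subshapeP _ ssT) h]|/andP[ssT /forall_entry hT]].
  have {}h := h (interlaces_size hk) sub_shape.
  have /semistandardP[rows cols] := ssT.
  apply/andP; split; last first.
    apply/forall_entry => r j hj; have hj' := lt_la _ _ hj.
    by have := h r j hj'; rewrite entry_extend // hj.
  apply/semistandardP; split=> [r j j' hj|r r' j hr hj hj'].
    have [h1 h2] : (j < nth 0 ka r)%N /\ (j' < nth 0 ka r)%N by lia.
    have := rows r j j'; rewrite !entry_extend ?lt_la // h1 h2; apply.
    by have := lt_la _ _ h2; lia.
  by have := cols r r' j hr (lt_la _ _ hj) (lt_la _ _ hj'); rewrite !entry_extend ?lt_la // hj hj'.
have /semistandardP[rows cols] := ssT.
have [sz hint] := interlacesP _ _ hk.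
have ssE : semistandard (extend_tab T).
  apply/semistandardP; split=> [r j j' hj|r r' j hr hj hj'].
    have [h1 h2] : (j < nth 0 la r)%N /\ (j' < nth 0 la r)%N by lia.
    rewrite !entry_extend //; case: (ltnP j') => h3; case: (ltnP j) => h4 //; try lia.
      by apply: rows; lia.
    exact/ltnW/hT.
  rewrite !entry_extend //.
  (* A cell above another one lies in [ka], since row [r] of [ka] is at least as long as row [r.+1]
     of [la]. *)
  have h1 : (j < nth 0 ka r)%N.
    apply: (leq_trans (leq_trans hj' (sorted_geq_nth sla hr))).
    suff hr' : (r < size la)%N by case/andP: (hint r hr').
    by rewrite ltnNge; apply: contraL hj => ?; rewrite nth_default.
  by rewrite h1; case: ifP => h2; [apply: cols | apply: hT].
apply/and3P; split=> //.
  apply/forall_entry => r j hj; rewrite entry_extend //; case: ifP => // h.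
  by rewrite ltnS; apply/ltnW/hT.
apply/subshapeP => // [|r j hj]; first exact: sub_shape.
by rewrite entry_extend //; case: ifP => [/hT|]; lia.
Qed.

Lemma prod_extend T :
  \prod_(c : cell la) x (extend_tab T c)
  = (\prod_(c : cell ka) x (T c)) * x m ^+ (sumn la - sumn ka).
Proof.
have sumE mu : sumn mu = (\sum_(0 <= r < size mu) nth 0 mu r)%N.
  by rewrite sumnE (big_nth 0%N).
have sz := interlaces_size hk.
rewrite !prod_cell !sumE sz.
rewrite -sumnB => [|r _]; last exact: sub_shape.
rewrite expr_sum -big_split /=; apply: eq_bigr => r _.
rewrite (big_cat_nat (n := nth 0%N ka r)) //=; last exact: sub_shape.
congr (_ * _).
  rewrite !big_nat; apply: eq_bigr => j /andP[_ hj].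
  by rewrite entry_extend ?hj //; apply: leq_trans hj (sub_shape r).
rewrite big_nat (eq_bigr (fun _ => x m)) => [|j hj]; last first.
  by rewrite entry_extend //; [rewrite ltnNge; case/andP: hj => -> | case/andP: hj].
by rewrite -big_nat prodr_const_nat.
Qed.

End Fixed.

(** Sort the tableaux by the shape of their entries below [m]; erasing the entries [m] gives the
    recursion that defines [schur_poly]. *)
Lemma tableau_sumE m la : (m <= M)%N -> sorted geq la -> tableau_sum m la = schur_poly x m la.
Proof.
elim: m la => [|m IH] la hm sla.
  rewrite /schur_poly /tableau_sum; case: eqP => h.
    have no (c : cell la) : False.
      have := cell_col_lt c; have := h; rewrite sumnE (big_nth 0%N) big_mkord => /eqP.
      rewrite sum_nat_eq0 => /forallP/(_ (tag c)) /= /eqP.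
      by rewrite /cell_row => ->.
    pose T0 : {ffun cell la -> 'I_M} := [ffun c => False_rect _ (no c)].
    rewrite (big_pred1 T0) => [|T]; first by rewrite big1 // => c; case: (no c).
    have -> : T = T0 by apply/ffunP => c; case: (no c).
    rewrite /= eqxx; apply/andP; split; last by apply/forallP => c; case: (no c).
    by apply/forallP => c; case: (no c).
  rewrite big1 // => T /andP[_ /forallP hT].
  exfalso; apply: h; rewrite sumnE (big_nth 0%N) big_mkord big1 // => i _.
  case e : (nth 0 la i)%N => [|j] //.
  by have [|c _ _] := @cellat_in la i 0; [rewrite e | have := hT c].
transitivity (\sum_(ka <- interl la) \sum_(T : {ffun cell la -> 'I_M} |
    [&& semistandard T, [forall c, T c < m.+1]%N & subshape m T == ka])
      \prod_(c : cell la) x (T c)).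
  rewrite (exchange_big_dep (fun T : {ffun cell la -> 'I_M} =>
    semistandard T && [forall c, T c < m.+1]%N)) /=; last first.
    by move=> ka T _ /and3P[-> ->].
  apply: eq_bigr => T /andP[ssT hT].
  rewrite (eq_bigl (pred1 (subshape m T))) => [|ka]; last by rewrite ssT hT /= eq_sym.
  rewrite -[RHS]big_filter (_ : filter _ _ = [:: subshape m T]) ?big_seq1 //.
  by apply: filter_pred1_uniq; [exact: box_uniq | exact/subshape_interl/forallP].
rewrite [RHS]/=; apply: eq_big_seq => ka; rewrite mem_interl => hk.
rewrite -IH ?(interlaces_sorted hk) //; last exact: ltnW.
rewrite (reindex_onto (@extend_tab m hm la ka) (@restrict_tab m hm la ka)) => [|T]; last first.
  by case/and3P; apply: extend_restrict.
rewrite /tableau_sum mulr_suml; apply: eq_big => T.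
  by rewrite semistandard_extend // restrict_extend // eqxx andbT.
by move=> _; apply: prod_extend.
Qed.

End Branching.

Definition xvar (C : fieldType) (m : nat) (i : nat) : {mpoly C[m]} :=
  if insub i is Some j then 'X_j else 0.

Lemma xvarE (C : fieldType) m (i : 'I_m) : xvar C m i = 'X_i.
Proof. by rewrite /xvar valK. Qed.

Lemma schurE (C : fieldType) la m : sorted geq la -> schur C la m = schur_poly (xvar C m) m la.
Proof.
move=> sla; rewrite -(tableau_sumE _ (leqnn m)) //.
apply: eq_big => [T|T _]; last by apply: eq_bigr => c _; rewrite xvarE.
by rewrite [X in _ && X](_ : _ = true) ?andbT //; apply/forallP => c.
Qed.

(** * Combinations of Schur functions of a given degree *)

Section Span.
Variable C : fieldType.
Local Notation S m la := (schur_poly (xvar C m) m la).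

(** The list [l] does not depend on [m], so the combination is one of symmetric functions. Its
    partitions may repeat and may end in zeros. *)
Definition schur_span (d : nat) (F : symfun C) : Prop :=
  exists2 l : seq (C * seq nat),
    all (fun t => sorted geq t.2 && (sumn t.2 == d)) l &
    forall m, F m = \sum_(t <- l) t.1 *: S m t.2.

Lemma eq_schur_span d F G : (forall m, F m = G m) -> schur_span d F -> schur_span d G.
Proof. by move=> e [l h1 h2]; exists l => // m; rewrite -e h2. Qed.

Lemma schur_span_ss d la :
  sorted geq la -> sumn la = d -> schur_span d (fun m => S m la).
Proof.
move=> s e; exists [:: (1, la)] => [|m]; first by rewrite /= s e eqxx.
by rewrite big_seq1 scale1r.
Qed.

Lemma schur_spanD d F G :
  schur_span d F -> schur_span d G -> schur_span d (fun m => F m + G m).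
Proof.
move=> [l h1 h2] [l' h1' h2']; exists (l ++ l') => [|m]; first by rewrite all_cat h1.
by rewrite big_cat h2 h2'.
Qed.

Lemma schur_spanZ d a F : schur_span d F -> schur_span d (fun m => a *: F m).
Proof.
move=> [l h1 h2]; exists [seq (a * t.1, t.2) | t <- l] => [|m]; first by rewrite all_map.
by rewrite big_map h2 scaler_sumr; apply: eq_bigr => t _; rewrite scalerA.
Qed.

Lemma schur_span_sum d (I : eqType) (s : seq I) (G : I -> symfun C) :
  {in s, forall i, schur_span d (G i)} -> schur_span d (fun m => \sum_(i <- s) G i m).
Proof.
elim: s => [|i s IH] h; first by exists [::] => // m; rewrite !big_nil.
apply: (@eq_schur_span _ (fun m => G i m + \sum_(j <- s) G j m)) => [m|].
  by rewrite big_cons.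
apply: schur_spanD; first by apply: h; rewrite inE eqxx.
by apply: IH => j js; apply: h; rewrite inE js orbT.
Qed.

(** Pieri's rule: the condition in [pieri] makes the new first part at least the head of the old
    partition, so the new sequences are again weakly decreasing. *)
Lemma schur_spanMh d r F :
  schur_span d F -> schur_span (d + r) (fun m => F m * S m [:: r]).
Proof.
move=> [l /allP h1 h2].
pose G (t : C * seq nat) (m : nat) := t.1 *: \sum_(ka <- [seq ka <- interl t.2 |
  (head 0 t.2 + sumn ka <= sumn t.2 + r)%N]) S m ((sumn t.2 + r - sumn ka)%N :: ka).
apply: (@eq_schur_span _ (fun m => \sum_(t <- l) G t m)) => [m|].
  rewrite h2 mulr_suml; apply: eq_bigr => t _.
  by rewrite -scalerAl pieri /G big_filter.
apply: schur_span_sum => t /h1/andP[st /eqP dt]; apply: schur_spanZ.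
apply: schur_span_sum => ka; rewrite mem_filter mem_interl => /andP[h hk].
have hs := interlaces_sumn hk; apply: schur_span_ss; last by rewrite /=; lia.
have := interlaces_sorted hk; have := interlaces_head hk.
by case: ka h hs {hk} => [|b ka] //= h hs hb ->; rewrite andbT; lia.
Qed.

(** Newton's identity writes p_r as r h_r minus the products p_i h_(r-i) with 0 < i < r; strong
    induction on [r] and [schur_spanMh] treat each term. *)
Lemma schur_spanMp d r F :
  schur_span d F -> (0 < r)%N -> schur_span (d + r) (fun m => F m * psum (xvar C m) m r).
Proof.
move=> hF; have [b] := ubnP r; elim: b r => // b IH [|r] // hb _.
pose G (i : 'I_r) (m : nat) := (F m * psum (xvar C m) m i.+1) * S m [:: (r - i)%N].
apply: (@eq_schur_span _ (fun m => r.+1%:R *: (F m * S m [:: r.+1])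
   + (-1) *: \sum_(i <- enum 'I_r) G i m)) => [m|].
  have := newton (xvar C m) m r.+1; rewrite big_ord_recr /= subnn schur_poly1_0 mulr1.
  rewrite scalerAr scaler_nat mulr_natl => <-.
  rewrite scaleN1r big_enum mulrDr addrAC mulr_sumr -sumrB big1 ?add0r // => i _.
  by rewrite /G subSS mulrA subrr.
apply: schur_spanD; apply: schur_spanZ; first exact: schur_spanMh.
apply: schur_span_sum => i _.
have -> : (d + r.+1 = (d + i.+1) + (r - i))%N by have := ltn_ord i; lia.
by apply: schur_spanMh; apply: IH => //; have := ltn_ord i; lia.
Qed.

Lemma power_sumE nu m : power_sum C nu m = \prod_(d <- nu) psum (xvar C m) m d.
Proof.
by apply: eq_bigr => d _; apply: eq_bigr => i _; rewrite xvarE.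
Qed.

Lemma schur_span_power_sum nu : 0%N \notin nu -> schur_span (sumn nu) (power_sum C nu).
Proof.
elim: nu => [|r nu IH].
  move=> _; apply: (@eq_schur_span _ (fun m => S m [::])) => [m|]; last exact: schur_span_ss.
  by rewrite power_sumE big_nil -schur_poly_rcons0 schur_poly1_0.
rewrite inE negb_or eq_sym => /andP[r0 /IH h].
rewrite [sumn _]addnC -lt0n in r0 *.
apply: eq_schur_span (schur_spanMp h r0) => m.
by rewrite !power_sumE big_cons mulrC.
Qed.

End Span.

(** * Power sums of cycle types as sums over colorings *)

Lemma porbit_eq_mem (T : finType) (w : {perm T}) (B : {set T}) i :
  B \in porbits w -> (porbit w i == B) = (i \in B).
Proof. by case/imsetP => y _ ->; rewrite eq_porbit_mem. Qed.

Lemma sumn_cycle_type n (w : 'S_n) : sumn (cycle_type w) = n.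
Proof.
rewrite sumnE (perm_big _ (permEl (perm_sort _ _))) /= big_map big_enum /=.
rewrite -[RHS]card_ord -sum1_card.
rewrite (partition_big (porbit w) (mem (porbits w))) => [|i _] /=; last exact: imset_f.
apply: eq_bigr => B hB; rewrite -sum1_card; apply: eq_bigl => i.
by rewrite porbit_eq_mem.
Qed.

Lemma cycle_type_pos n (w : 'S_n) : 0%N \notin cycle_type w.
Proof.
rewrite mem_sort; apply/mapP => -[B]; rewrite mem_enum => /imsetP[x _ ->] /esym/eqP.
exact/negP/card_porbit_neq0.
Qed.

Section Colorings.
Variables (C : fieldType) (m : nat).

Definition monomial (n : nat) (g : {ffun 'I_n -> 'I_m}) : {mpoly C[m]} :=
  \prod_i 'X_(g i).

Definition invariant_coloring (n : nat) (w : 'S_n) (g : {ffun 'I_n -> 'I_m}) : bool :=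
  [forall i, g (w i) == g i].

(** Expanding the product of power sums chooses a color for each cycle, that is, a coloring of the
    points constant on cycles. *)
Lemma power_sum_cycle_type n (w : 'S_n) :
  power_sum C (cycle_type w) m = \sum_(g | invariant_coloring w g) monomial g.
Proof.
rewrite /power_sum (perm_big _ (permEl (perm_sort _ _))) /= big_map big_enum /=.
pose orbT := {B : {set 'I_n} | B \in porbits w}.
have ex (B : orbT) : exists i, i \in val B.
  by case: B => B /= /imsetP[x _ ->]; exists x; apply: porbit_id.
have orbP i : porbit w i \in porbits w by apply: imset_f.
pose orb i : orbT := Sub (porbit w i) (orbP i).
have orbE i B : (orb i == B) = (i \in val B).
  by rewrite -val_eqE /= porbit_eq_mem // (valP B).
rewrite big_sub /= bigA_distr_bigA /=.
(* [h] spreads the colors of the cycles over their points; [h'] reads the color at a chosen point of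
   each cycle. *)
pose h (G : {ffun orbT -> 'I_m}) : {ffun 'I_n -> 'I_m} := [ffun i => G (orb i)].
pose h' (g : {ffun 'I_n -> 'I_m}) : {ffun orbT -> 'I_m} := [ffun B => g (xchoose (ex B))].
rewrite [RHS](reindex_onto h h') => [|g /forallP hg]; last first.
  apply/ffunP => i; rewrite !ffunE.
  have /porbitP[j ->] := xchooseP (ex (orb i)).
  elim: j => [|j IH]; first by rewrite expg0 perm1.
  by rewrite expgSr permM (eqP (hg _)).
apply: eq_big => [G|G _].
  apply/esym/andP; split.
    apply/forallP => i; rewrite !ffunE; apply/eqP; congr (G _); apply/eqP.
    by rewrite orbE /= -{1}[w]expg1 mem_porbit.
  apply/eqP/ffunP => B; rewrite !ffunE; congr (G _); apply/eqP.
  by rewrite orbE (xchooseP (ex B)).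
rewrite /monomial (partition_big orb xpredT) //=; apply: eq_bigr => B _.
rewrite (eq_bigr (fun _ => 'X_(G B))) => [|i /eqP <-]; last by rewrite ffunE.
rewrite prodr_const; congr (_ ^+ _); apply: eq_card => i.
by rewrite -[LHS]orbE.
Qed.

(** Composing with [v] turns the colorings invariant under [w ^ v] into those invariant under [w]
    and keeps the monomial. *)
Lemma power_sum_cycle_type_conj n (w v : 'S_n) :
  power_sum C (cycle_type (w ^ v)%g) m = power_sum C (cycle_type w) m.
Proof.
rewrite !power_sum_cycle_type.
pose h (g : {ffun 'I_n -> 'I_m}) : {ffun 'I_n -> 'I_m} := [ffun i => g (v i)].
pose h' (g : {ffun 'I_n -> 'I_m}) : {ffun 'I_n -> 'I_m} := [ffun i => g ((v^-1)%g i)].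
have hK : cancel h h' by move=> g; apply/ffunP => i; rewrite !ffunE permKV.
have hK' : cancel h' h by move=> g; apply/ffunP => i; rewrite !ffunE permK.
rewrite [RHS](reindex h) /=; last by exists h' => g _; [apply: hK | apply: hK'].
apply: eq_big => [g|g _]; last first.
  by rewrite /monomial (reindex_inj (@perm_inj _ v)); apply: eq_bigr => i _; rewrite ffunE.
apply/forallP/forallP => hg i.
  by rewrite !ffunE -permJ.
by have := hg ((v^-1)%g i); rewrite !ffunE -permJ permKV.
Qed.

Definition sorted_coloring (n : nat) (g : {ffun 'I_n -> 'I_m}) : bool :=
  sorted leq [seq val (g i) | i <- enum 'I_n].

Lemma sorted_coloringP n (g : {ffun 'I_n -> 'I_m}) :
  reflect (forall i j : 'I_n, (i < j)%N -> (g i <= g j)%N) (sorted_coloring g).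
Proof.
have sz : size [seq val (g i) | i <- enum 'I_n] = n by rewrite size_map size_enum_ord.
have nthE (i : 'I_n) : nth 0%N [seq val (g i) | i <- enum 'I_n] i = g i.
  by rewrite (nth_map i) ?size_enum_ord // nth_ord_enum.
apply: (iffP idP) => [s i j hij|h].
  rewrite -!nthE; apply: (sorted_leq_nth leq_trans leqnn 0%N s); rewrite ?inE ?sz //.
  exact: ltnW.
apply/(sortedP 0%N) => i; rewrite sz => hi.
rewrite -[i]/(nat_of_ord (Ordinal (ltnW hi))) -[_.+1]/(nat_of_ord (Ordinal hi)) !nthE.
exact: h.
Qed.

Definition perm_coloring n (g : {ffun 'I_n -> 'I_m}) (v : 'S_n) : {ffun 'I_n -> 'I_m} :=
  [ffun i => g (v i)].

Lemma exists_sorting_perm n (g : {ffun 'I_n -> 'I_m}) :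
  exists v : 'S_n, sorted_coloring (perm_coloring g v).
Proof.
pose t := [tuple val (g i) | i < n].
have /tuple_permP[v hv] : perm_eq (sort leq t) t by rewrite perm_sort.
exists v; rewrite /sorted_coloring.
have -> : [seq val (perm_coloring g v i) | i <- enum 'I_n] = sort leq t.
  by rewrite hv /=; apply: eq_map => i; rewrite ffunE tnth_mktuple.
exact: (sort_sorted leq_total).
Qed.

(** A multiset of colors has only one sorted arrangement, so two sorting permutations give the same
    coloring. *)
Lemma sorted_perm_coloring n (g : {ffun 'I_n -> 'I_m}) (u w : 'S_n) :
  sorted_coloring (perm_coloring g u) ->
  sorted_coloring (perm_coloring g (u * w)%g) = invariant_coloring w g.
Proof.
move=> su; apply/idP/forallP => [suw i|hw]; last first.
  rewrite (_ : perm_coloring _ _ = perm_coloring g u) //; apply/ffunP => i.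
  by rewrite !ffunE permM (eqP (hw _)).
have pe (v : 'S_n) : perm_eq [seq val (perm_coloring g v i) | i <- enum 'I_n]
                             [seq val (g i) | i <- enum 'I_n].
  rewrite (_ : [seq val (perm_coloring g v i) | i <- enum 'I_n] =
    [seq val (g i) | i <- [seq v i | i <- enum 'I_n]]); last first.
    by rewrite -[RHS]map_comp; apply: eq_map => j; rewrite /= ffunE.
  apply: perm_map; apply: uniq_perm; rewrite ?enum_uniq ?(map_inj_uniq perm_inj) ?enum_uniq //.
  by move=> j; rewrite mem_enum; apply/mapP; exists ((v^-1)%g j); rewrite ?mem_enum ?permKV.
have := pe (u * w)%g; rewrite perm_sym => /(perm_trans (pe u)).
move/(sorted_eq leq_trans anti_leq su suw).
move/eq_in_map => /(_ ((u^-1)%g i)); rewrite mem_enum !ffunE permM permKV => e.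
by rewrite -val_eqE e.
Qed.

(** Weakly increasing colorings are the semistandard fillings of a single row. *)
Lemma sum_sorted_coloring n :
  \sum_(g : {ffun 'I_n -> 'I_m} | sorted_coloring g) monomial g = schur_poly (xvar C m) m [:: n].
Proof.
rewrite -schurE //.
pose f (j : 'I_n) : cell [:: n] :=
  Tagged (fun i : 'I_(size [:: n]) => 'I_(nth 0%N [:: n] i)) (i := ord0) j.
have colP (c : cell [:: n]) : (cell_col c < n)%N.
  by have := cell_col_lt c; case: c => [[[|i] hi] k].
pose f' (c : cell [:: n]) : 'I_n := Ordinal (colP c).
have fK : cancel f f' by move=> j; apply: val_inj.
have fK' : cancel f' f.
  case=> i; rewrite (ord1 i : i = ord0 :> 'I_(size [:: n])) => k.
  by congr (Tagged _ _); apply: val_inj.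
pose h (g : {ffun 'I_n -> 'I_m}) : {ffun cell [:: n] -> 'I_m} := [ffun c => g (f' c)].
pose h' (T : {ffun cell [:: n] -> 'I_m}) : {ffun 'I_n -> 'I_m} := [ffun j => T (f j)].
have hK : cancel h h' by move=> g; apply/ffunP => j; rewrite !ffunE fK.
have hK' : cancel h' h by move=> T; apply/ffunP => c; rewrite !ffunE fK'.
rewrite /schur (reindex h) /=; last by exists h' => T _; [apply: hK | apply: hK'].
apply: eq_big => [g|g _]; last first.
  rewrite /monomial (reindex f) /=; last by exists f' => c _; [apply: fK | apply: fK'].
  by apply: eq_bigr => j _; rewrite ffunE fK.
have row0 (c : cell [:: n]) : cell_row c = 0%N by case: c => [[[|i] hi] k].
apply/sorted_coloringP/forallP => [hg c|hT i j hij].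
  apply/forallP => d; rewrite !ffunE !row0 ltnn andbF /= andbT.
  by apply/implyP => hcd; apply: hg.
have /forallP/(_ (f j))/andP[/implyP + _] := hT (f i).
by rewrite !ffunE !fK; apply.
Qed.

(* For a coloring [g] with [g \o u] sorted, [w |-> w \o u] maps the stabilizer of [g] onto the
   permutations sorting [g]. *)
Lemma sum_power_sum_cycle_type n :
  \sum_(w : 'S_n) power_sum C (cycle_type w) m = n`!%:R *: schur_poly (xvar C m) m [:: n].
Proof.
rewrite -sum_sorted_coloring.
under eq_bigr => w _ do rewrite power_sum_cycle_type.
rewrite (exchange_big_dep xpredT) //=.
transitivity (\sum_(g : {ffun 'I_n -> 'I_m})
    \sum_(v : 'S_n | sorted_coloring (perm_coloring g v)) monomial g).
  apply: eq_bigr => g _; have [u su] := exists_sorting_perm g.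
  rewrite [RHS](reindex_inj (mulgI u)) /=.
  by apply: eq_bigl => w; rewrite sorted_perm_coloring.
rewrite (exchange_big_dep xpredT) //=.
(* For fixed [v], composing with [v] permutes the colorings, so each of the n! permutations
   contributes the same sum. *)
transitivity (\sum_(v : 'S_n) \sum_(g : {ffun 'I_n -> 'I_m} | sorted_coloring g) monomial g).
  apply: eq_bigr => v _.
  have inj : injective (fun g => perm_coloring g v).
    move=> g g' /ffunP e; apply/ffunP => i.
    by have := e ((v^-1)%g i); rewrite !ffunE permKV.
  rewrite [RHS](reindex_inj inj) /=; apply: eq_bigr => g _.
  by rewrite /monomial (reindex_inj (@perm_inj _ v)); apply: eq_bigr => i _; rewrite ffunE.
by rewrite sumr_const card_Sn scaler_nat.
Qed.

(** Such a [w] is [sg] on the image of [x] glued to an arbitrary permutation of the other points,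
    and its invariant colorings are pairs of invariant colorings of the two pieces. *)
Lemma sum_extending_perm n k (x : 'I_k -> 'I_n) (sg : 'S_k) : injective x ->
  \sum_(w : 'S_n | [forall p, w (x p) == x (sg p)]) power_sum C (cycle_type w) m
  = power_sum C (cycle_type sg) m * ((n - k)`!%:R *: schur_poly (xvar C m) m [:: (n - k)%N]).
Proof.
move=> x_inj; rewrite -sum_power_sum_cycle_type mulr_sumr.
pose A := ~: [set x p | p in 'I_k].
have le_kn : (k <= n)%N by have := leq_card x x_inj; rewrite !card_ord.
have cardA : #|A| = (n - k)%N by rewrite cardsCs setCK card_imset // !card_ord.
pose f (z : 'I_k + 'I_(n - k)) : 'I_n :=
  match z with inl p => x p | inr a => enum_val (cast_ord (esym cardA) a) end.
have f_inj : injective f.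
  have no p a : x p <> enum_val (cast_ord (esym cardA) a).
    move=> e; have := enum_valP (cast_ord (esym cardA) a).
    by rewrite -e /A inE imset_f.
  case=> [p|a] [q|b] //=; first by move/x_inj->.
  - by move/no.
  - by move/esym/no.
  by move/enum_val_inj/cast_ord_inj->.
have [f' fK fK'] : bijective f.
  by apply: inj_card_bij => //; rewrite card_sum !card_ord subnKC.
pose glue (u : 'S_(n - k)) (z : 'I_k + 'I_(n - k)) : 'I_k + 'I_(n - k) :=
  match z with inl p => inl (sg p) | inr a => inr (u a) end.
have glue_inj u : injective (fun i => f (glue u (f' i))).
  move=> i j /f_inj e; apply: (can_inj fK').
  by move: e; case: (f' i) => [p|a]; case: (f' j) => [q|b] //= [] /perm_inj ->.
pose W u : 'S_n := perm (@glue_inj u).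
have WE u z : W u (f z) = f (glue u z) by rewrite permE fK.
have W_inj : injective W.
  move=> u v e; apply/permP => a.
  by have := WE u (inr a); rewrite e WE => /f_inj[].
have imW (w : 'S_n) : [forall p, w (x p) == x (sg p)] = (w \in [set W u | u in 'S_(n - k)]).
  apply/forallP/imsetP => [hw|[u _ ->] p]; last by rewrite -[x p]/(f (inl p)) WE.
  (* A point outside the image of [x] cannot be sent to [x q], which is already the value at
     [x ((sg^-1)%g q)]. *)
  have hr a : exists b, w (f (inr a)) = f (inr b).
    case e : (f' (w (f (inr a)))) => [q|b]; last by exists b; rewrite -e fK'.
    have : w (f (inr a)) = w (f (inl ((sg^-1)%g q))).
      by rewrite (eqP (hw _)) permKV -[RHS]/(f (inl q)) -e fK'.
    by move/perm_inj/f_inj.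
  have {}hr a : exists b, w (f (inr a)) == f (inr b) by have [b ->] := hr a; exists b.
  pose u a := xchoose (hr a).
  have uE a : w (f (inr a)) = f (inr (u a)) by apply/eqP/(xchooseP (hr a)).
  have u_inj : injective u.
    by move=> a b e; have := uE a; rewrite e -uE => /perm_inj/f_inj[].
  exists (perm u_inj) => //; apply/permP => i; rewrite -(fK' i) WE.
  by case: (f' i) => [p|a] /=; rewrite ?(eqP (hw p)) // permE uE.
rewrite (eq_bigl _ _ imW) big_imset /=; last by move=> u v _ _; apply: W_inj.
apply: eq_bigr => u _; rewrite !power_sum_cycle_type big_distrlr /= pair_big_dep /=.
pose h (g : {ffun 'I_k -> 'I_m} * {ffun 'I_(n - k) -> 'I_m}) : {ffun 'I_n -> 'I_m} :=
  [ffun i => match f' i with inl p => g.1 p | inr a => g.2 a end].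
pose h' (g : {ffun 'I_n -> 'I_m}) : {ffun 'I_k -> 'I_m} * {ffun 'I_(n - k) -> 'I_m} :=
  ([ffun p => g (f (inl p))], [ffun a => g (f (inr a))]).
have hK : cancel h h'.
  by case=> g1 g2; congr (_, _); apply/ffunP => z; rewrite !ffunE fK.
have hK' : cancel h' h.
  move=> g; apply/ffunP => i; rewrite ffunE -{2}(fK' i).
  by case: (f' i) => z; rewrite ffunE.
rewrite (reindex h) /=; last by exists h' => g _; [apply: hK | apply: hK'].
apply: eq_big => [[g1 g2]|[g1 g2] _] /=.
  apply/forallP/andP => [hg|[/forallP h1 /forallP h2] i].
    split; apply/forallP => z.
      by have := hg (f (inl z)); rewrite WE !ffunE !fK.
    by have := hg (f (inr z)); rewrite WE !ffunE !fK.
  by rewrite -(fK' i) WE !ffunE !fK; case: (f' i) => z /=.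
rewrite /monomial (reindex f) /=; last by exists f' => z _; [apply: fK | apply: fK'].
by rewrite big_sumType; congr (_ * _); apply: eq_bigr => z _; rewrite ffunE fK.
Qed.

End Colorings.

(** * Sums over the extensions of a partial permutation *)

Section PaddedSpan.
Variable C : numFieldType.
Local Notation S m la := (schur_poly (xvar C m) m la).

(** One list [l] serves all [n] and [m]. The size of a polynomial is its degree plus one, so the
    coefficient of a partition t has degree at most k - |t|. *)
Definition padded_span (k : nat) (D : pred nat) (f : nat -> symfun C) : Prop :=
  exists2 l : seq ({poly C} * seq nat),
    all (fun t : {poly C} * seq nat =>
      [&& sorted geq t.2, (sumn t.2 <= k)%N & (size t.1 <= (k - sumn t.2).+1)%N]) l &
    forall n m, D n -> (2 * k <= n)%N ->
      f n m = \sum_(t <- l) t.1.[n%:R] *: S m (padded t.2 n).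

Lemma eq_padded_span k (D D' : pred nat) f g :
  (forall n m, D' n -> (2 * k <= n)%N -> D n /\ f n m = g n m) ->
  padded_span k D f -> padded_span k D' g.
Proof.
move=> e [l h1 h2]; exists l => // n m hn kn.
by have [dn <-] := e n m hn kn; apply: h2.
Qed.

Lemma padded_spanD k D f g : padded_span k D f -> padded_span k D g ->
  padded_span k D (fun n m => f n m + g n m).
Proof.
move=> [l h1 h2] [l' h1' h2']; exists (l ++ l') => [|n m hn kn].
  by rewrite all_cat h1.
by rewrite big_cat h2 // h2'.
Qed.

(** Raising [k] by the degree bound of the factor preserves the bound on the coefficients. *)
Lemma padded_spanM k j D (q : {poly C}) f : (size q <= j.+1)%N -> padded_span k D f ->
  padded_span (k + j) D (fun n m => q.[n%:R] *: f n m).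
Proof.
move=> hq [l h1 h2]; exists [seq (q * t.1, t.2) | t <- l] => [|n m hn kn].
  rewrite all_map; apply: sub_all h1 => t /= /and3P[-> h3 h4] /=.
  apply/andP; split; first by lia.
  apply: leq_trans (size_polyMleq q t.1) _.
  by move: hq h3 h4; move: (size q) (size t.1) (sumn t.2) => a b c; lia.
rewrite h2 //; last by lia.
by rewrite big_map scaler_sumr; apply: eq_bigr => t _; rewrite hornerM scalerA.
Qed.

Lemma padded_span_sum k D (I : eqType) (s : seq I) (f : I -> nat -> symfun C) :
  {in s, forall i, padded_span k D (f i)} ->
  padded_span k D (fun n m => \sum_(i <- s) f i n m).
Proof.
elim: s => [|i s IH] h; first by exists [::] => // n m _ _; rewrite !big_nil.
apply: (@eq_padded_span _ D _ (fun n m => f i n m + \sum_(j <- s) f j n m)) => [n m hn _|].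
  by rewrite big_cons.
apply: padded_spanD; first by apply: h; rewrite inE eqxx.
by apply: IH => j js; apply: h; rewrite inE js orbT.
Qed.

(** In [pieri] the new first part is n - |ka|, so padded partitions appear; [2 * d <= n] makes the
    condition on [ka] automatic. *)
Lemma padded_span_mulh d D F : schur_span d F ->
  padded_span d D (fun n m => F m * S m [:: (n - d)%N]).
Proof.
move=> [l /allP h1 h2].
exists (flatten [seq [seq (t.1%:P, ka) | ka <- interl t.2] | t <- l]) => [|n m _ kn].
  apply/allP => u /flatten_mapP[t /h1/andP[st /eqP dt] /mapP[ka + ->]] /=.
  rewrite mem_interl => hk; rewrite (interlaces_sorted hk) -dt (interlaces_sumn hk) /=.
  exact: leq_trans (size_polyC_leq1 _) _.
rewrite big_flatten big_map h2 mulr_suml; apply: eq_big_seq => t /h1/andP[st /eqP dt].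
rewrite -scalerAl pieri big_map scaler_sumr [LHS]big_mkcond; apply: eq_big_seq => ka.
rewrite mem_interl => hk; have hs := interlaces_sumn hk.
have hh : (head 0 t.2 <= sumn t.2)%N by case: (t.2) => //= a s; rewrite leq_addr.
rewrite dt in hs hh; rewrite hornerC dt subnKC ?ifT //;
  by move: hs hh kn; move: (head 0%N t.2) (sumn ka) => a b; lia.
Qed.

End PaddedSpan.

(** The edges are pairs of natural numbers, counted from 0, so that the same [s] serves for every
    [n]. *)
Definition extends n (s : seq (nat * nat)) (w : 'S_n) : bool :=
  all (fun p => [exists i : 'I_n, (val i == p.1) && (val (w i) == p.2)]) s.

Arguments extends : simpl never.

Definition vertices (s : seq (nat * nat)) : seq nat := undup (unzip1 s ++ unzip2 s).

Lemma mem_vertices s v : (v \in vertices s) = (v \in unzip1 s) || (v \in unzip2 s).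
Proof. by rewrite mem_undup mem_cat. Qed.

Definition fits (s : seq (nat * nat)) : pred nat := fun n => all (fun v => v < n)%N (vertices s).

Lemma existsb_ord_pair n (w : 'S_n) (a b : 'I_n) :
  [exists i : 'I_n, (val i == a) && (val (w i) == b)] = (w a == b).
Proof.
apply/existsP/idP => [[i /andP[/eqP/val_inj -> ]]|/eqP e]; first by rewrite val_eqE.
by exists a; rewrite e !eqxx.
Qed.

Lemma size_vertices_le s n : fits s n -> (size (vertices s) <= n)%N.
Proof.
move=> /allP h; rewrite -[leqRHS](size_iota 0); apply: uniq_leq_size; first exact: undup_uniq.
by move=> v /h; rewrite mem_iota.
Qed.

Section Sums.
Variable C : numFieldType.

Definition extension_sum n s m : {mpoly C[m]} :=
  \sum_(w : 'S_n | extends s w) power_sum C (cycle_type w) m.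

(** As every target is also a source, the edges permute the vertices, and [sum_extending_perm]
    applies. *)
Lemma extension_sum_cycles (s : seq (nat * nat)) :
  uniq (unzip1 s) -> uniq (unzip2 s) -> {subset unzip2 s <= unzip1 s} ->
  padded_span (size s) (fits s)
    (fun n m => (n - size (vertices s))`!%:R^-1 *: extension_sum n s m).
Proof.
move=> us ut sub; pose k := size s.
have sz1 : size (unzip1 s) = k by rewrite size_map.
have sz2 : size (unzip2 s) = k by rewrite size_map.
have szS : size (vertices s) = k.
  rewrite -sz1 -[in RHS](undup_id us); apply/perm_size/perm_undup => v.
  by rewrite mem_cat; case: (boolP (v \in unzip2 s)) => [/sub ->|]; rewrite ?orbT ?orbF.
have mem2 (p : 'I_k) : nth 0%N (unzip2 s) p \in unzip1 s.
  by apply/sub/mem_nth; rewrite sz2.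
(* The permutation [sg] sends an edge to the edge that starts at its target. *)
have sgP (p : 'I_k) : (index (nth 0 (unzip2 s) p) (unzip1 s) < k)%N.
  by rewrite -[ltnRHS]sz1 index_mem.
have sg_inj : injective (fun p : 'I_k => Ordinal (sgP p)).
  move=> p q [] e.
  have /eqP : nth 0%N (unzip2 s) p = nth 0%N (unzip2 s) q.
    by rewrite -[LHS](nth_index 0%N (mem2 p)) e nth_index.
  by rewrite nth_uniq ?sz2 // => /eqP/val_inj.
pose sg : 'S_k := perm sg_inj.
have hsp : schur_span k (power_sum C (cycle_type sg)).
  by have := schur_span_power_sum C (cycle_type_pos sg); rewrite sumn_cycle_type.
apply: eq_padded_span (padded_span_mulh xpredT hsp) => n m /allP hn _; split=> //.
have xP (p : 'I_k) : (nth 0 (unzip1 s) p < n)%N.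
  by apply: hn; rewrite mem_vertices mem_nth // sz1.
have x_inj : injective (fun p : 'I_k => Ordinal (xP p)).
  by move=> p q [] /eqP; rewrite nth_uniq ?sz1 // => /eqP/val_inj.
rewrite /extension_sum (eq_bigl (fun w : 'S_n =>
    [forall p, w (Ordinal (xP p)) == Ordinal (xP (sg p))])) => [|w]; last first.
  have yE (p : 'I_k) : val (Ordinal (xP (sg p))) = (nth (0, 0)%N s p).2.
    by rewrite /= permE /= nth_index // (nth_map (0, 0)%N).
  have x1E (p : 'I_k) : val (Ordinal (xP p)) = (nth (0, 0)%N s p).1.
    by rewrite /= (nth_map (0, 0)%N).
  apply/(all_nthP (0, 0)%N)/forallP => [h p|h p hp].
    by have := h p (ltn_ord p); rewrite -x1E -yE existsb_ord_pair.
  have := h (Ordinal hp); rewrite -existsb_ord_pair.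
  by under eq_existsb => i do rewrite x1E yE.
rewrite sum_extending_perm // szS -scalerAr scalerA mulVf ?scale1r //.
by rewrite Num.Theory.pnatr_eq0 -lt0n fact_gt0.
Qed.

Lemma extends_cons n (i y : 'I_n) s (w : 'S_n) :
  extends ((nat_of_ord i, nat_of_ord y) :: s) w = (w i == y) && extends s w.
Proof. by rewrite /extends /= existsb_ord_pair. Qed.

Lemma extension_sum_split n (i : 'I_n) s m :
  extension_sum n s m = \sum_(y < n) extension_sum n ((nat_of_ord i, nat_of_ord y) :: s) m.
Proof.
rewrite /extension_sum (partition_big (fun w : 'S_n => w i) xpredT) //=.
by apply: eq_bigr => y _; apply: eq_bigl => w; rewrite extends_cons andbC.
Qed.

(** [y] is already the image of a source of [s], which differs from [i]. *)
Lemma extension_sum_collision n (i y : 'I_n) s m :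
  nat_of_ord i \notin unzip1 s -> nat_of_ord y \in unzip2 s ->
  extension_sum n ((nat_of_ord i, nat_of_ord y) :: s) m = 0.
Proof.
move=> hi /mapP[p ps e]; apply: big_pred0 => w; rewrite extends_cons.
apply/negP => /andP[/eqP wi /allP/(_ p ps)/existsP[a /andP[/eqP ea /eqP eb]]].
case/negP: hi; suff -> : i = a by rewrite ea map_f.
by apply: (@perm_inj _ w); rewrite wi; apply: val_inj; rewrite eb.
Qed.

(* Conjugation by the transposition of [y] and [z] fixes the other points. *)
Lemma extension_sum_fresh n (i y z : 'I_n) s m : fits s n -> y != i -> z != i ->
  nat_of_ord y \notin vertices s -> nat_of_ord z \notin vertices s ->
  extension_sum n ((nat_of_ord i, nat_of_ord y) :: s) m
  = extension_sum n ((nat_of_ord i, nat_of_ord z) :: s) m.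
Proof.
move=> /allP fs yi zi ys zs; pose t := tperm y z.
rewrite /extension_sum [RHS](reindex_inj (conjg_inj t)) /=.
apply: eq_big => [w|w _]; last by rewrite power_sum_cycle_type_conj.
have conjE (a b : 'I_n) : y != a -> z != a -> ((w ^ t)%g a == b) = (w a == t b).
  move=> ya za; have ta : t a = a by rewrite tpermD.
  rewrite -{1}ta permJ -(inj_eq (@perm_inj _ t) (w a)); congr (_ == _).
  by rewrite tpermK.
rewrite !extends_cons conjE // tpermR; congr (_ && _).
apply: eq_in_all => -[a b] ps.
have a_s : a \in vertices s by rewrite mem_vertices (map_f fst ps).
have b_s : b \in vertices s by rewrite mem_vertices (map_f snd ps) orbT.
have E (u v : 'I_n) : val v \in vertices s -> val u \notin vertices s -> u != v.
  by move=> hv; apply: contraNneq => ->.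
rewrite -[a]/(nat_of_ord (Ordinal (fs a a_s))) -[b]/(nat_of_ord (Ordinal (fs b b_s))).
by rewrite !existsb_ord_pair conjE ?E // tpermD ?E.
Qed.

(** Sort the extensions by their value at [i]. Targets of [s] collide, and all values outside the
    vertices and [i] itself contribute alike. The value [i] is kept apart because it closes a
    loop. *)
Lemma extension_sum_rec n (i j : 'I_n) s m : fits s n -> nat_of_ord i \notin unzip1 s ->
  j != i -> nat_of_ord j \notin vertices s ->
  extension_sum n s m
  = \sum_(y <- [seq y <- undup (nat_of_ord i :: vertices s) | y \notin unzip2 s])
       extension_sum n ((nat_of_ord i, y) :: s) m
    + (n - size (undup (nat_of_ord i :: vertices s)))%:R
      *: extension_sum n ((nat_of_ord i, nat_of_ord j) :: s) m.
Proof.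
move=> fs hi ji js; set V := undup _.
have Vn v : v \in V -> (v < n)%N.
  by rewrite mem_undup inE => /predU1P[-> //|]; apply: (allP fs).
rewrite (extension_sum_split i).
rewrite -(big_mkord xpredT (fun y => extension_sum n ((nat_of_ord i, y) :: s) m)).
rewrite (bigID (mem V)) /=; congr (_ + _).
  rewrite -big_filter (perm_big V) /=; last first.
    apply: uniq_perm; [exact/filter_uniq/iota_uniq | exact: undup_uniq | move=> y].
    rewrite mem_filter mem_index_iota /=.
    by case: (boolP (y \in V)) => //= /Vn ->.
  rewrite big_filter [RHS]big_mkcond; apply: eq_big_seq => y /Vn hy.
  case: ifP => // /negbFE hc.
  exact: (@extension_sum_collision _ i (Ordinal hy)).
pose G := extension_sum n ((nat_of_ord i, nat_of_ord j) :: s) m.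
rewrite big_seq_cond (eq_bigr (fun _ => G)); last first.
  move=> y /andP[]; rewrite mem_index_iota => /= hy.
  rewrite mem_undup inE negb_or => /andP[h1 h2].
  exact: (@extension_sum_fresh _ i (Ordinal hy)).
rewrite -big_seq_cond big_const_seq iter_addr_0 scaler_nat; congr (_ *+ _).
have e := count_predC (mem V) (index_iota 0 n); rewrite size_iota subn0 in e.
suff e2 : count (mem V) (index_iota 0 n) = size V.
  transitivity (size V + count (predC (mem V)) (index_iota 0 n) - size V)%N.
    by rewrite addKn.
  by rewrite -[X in (X + _)%N]e2 e.
rewrite -size_filter; apply: perm_size.
apply: uniq_perm; [exact/filter_uniq/iota_uniq | exact: undup_uniq | move=> y].
rewrite mem_filter mem_index_iota /=.
by case: (boolP (y \in V)) => //= /Vn ->.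
Qed.

Lemma perm_extension_sum n s s' m :
  perm_eq s s' -> extension_sum n s m = extension_sum n s' m.
Proof. by move=> h; apply: eq_bigl => w; apply: perm_all. Qed.

Lemma perm_vertices s s' : perm_eq s s' -> perm_eq (vertices s) (vertices s').
Proof.
move=> h; apply: perm_undup => v; rewrite !mem_cat.
by rewrite !(perm_mem (perm_map _ h)).
Qed.

(** Solve [extension_sum_rec] for the term of [s] and divide by (n - |V|)!: the factor n - |V|
    reduces this to the factorial for the |V| + 1 vertices of [s], and all other terms have fewer
    vertices. *)
Lemma extension_sum_span s : uniq (unzip1 s) -> uniq (unzip2 s) ->
  padded_span (size s) (fits s)
    (fun n m => (n - size (vertices s))`!%:R^-1 *: extension_sum n s m).
Proof.
have [b] := ubnP (size (vertices s)); elim: b s => // b IH s hb us ut.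
case: (boolP (all (mem (unzip1 s)) (unzip2 s))) => [/allP sub|].
  exact: extension_sum_cycles.
(* [j] is a target but not a source; [s'] will be [s] without the edge from [i] to [j]. *)
case/allPn => j /mapP[[i j'] ps /= ->] {j} hj; move: j' ps hj => j ps hj.
have pe := perm_to_rem ps; move: (rem _ _) pe => s' pe.
rewrite (perm_size pe) /=.
have us' : uniq (i :: unzip1 s') by rewrite -(perm_uniq (perm_map fst pe)).
have ut' : uniq (j :: unzip2 s') by rewrite -(perm_uniq (perm_map snd pe)).
have [/andP[hi u1] /andP[hj' u2]] := (us', ut').
pose V := undup (i :: vertices s').
have hji : j != i /\ j \notin unzip1 s'.
  by move: hj; rewrite (perm_mem (perm_map fst pe)) /= inE negb_or => /andP.
have [ji j1] := hji.
have jV : j \notin V by rewrite mem_undup inE mem_vertices (negbTE ji) (negbTE j1).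
have memV v : v \in V = [|| v == i, v \in unzip1 s' | v \in unzip2 s'].
  by rewrite mem_undup inE mem_vertices.
have szS : size (vertices s) = (size V).+1.
  rewrite (perm_size (perm_vertices pe)) -[RHS]/(size (j :: V)); apply: perm_size.
  apply: uniq_perm; rewrite ?undup_uniq //= ?jV ?undup_uniq //.
  move=> v; rewrite mem_vertices /= !inE memV; do !case: (_ == _) => //=; by rewrite ?orbT.
have supV y : y \in V -> perm_eq (vertices ((i, y) :: s')) V.
  move=> yV; apply: uniq_perm; rewrite ?undup_uniq // => v.
  rewrite mem_vertices /= !inE; case: (eqVneq v y) => [->|_]; first by rewrite yV orbT.
  by rewrite memV; case: (v == i); case: (v \in unzip1 s').
have fitsV n v : fits s n -> v \in V -> (v < n)%N.
  move=> /allP fs vV; apply: fs; rewrite (perm_mem (perm_vertices pe)) mem_vertices /= !inE.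
  by move: vV; rewrite memV; do !case: (_ == _) => //=; case: (_ \in _).
pose c := size (vertices s').
(* If [i] is lost with the edge, then |V| = c + 1, and passing from (n - c)! to (n - |V|)! costs the
   factor n - c. Its degree 1 is made up for by the edge missing in [s']. *)
pose q : {poly C} := if i \in vertices s' then 1 else 'X - c%:R%:P.
have hq : (size q <= 2)%N.
  by rewrite /q; case: ifP; rewrite ?size_poly1 // size_XsubC.
have szV : size V = (c + (i \notin vertices s'))%N.
  by rewrite /V /= (undup_id (undup_uniq _)); case: (i \in _); rewrite /= ?addn0 ?addn1.
have szc : (c <= size V)%N by rewrite szV leq_addr.
have IH1 : padded_span (size s' + 1) (fits s') (fun n m =>
    q.[n%:R] *: ((n - c)`!%:R^-1 *: extension_sum n s' m)).
  apply: (@padded_spanM _ _ 1 _ _ (fun n m => (n - c)`!%:R^-1 *: extension_sum n s' m) hq).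
  by apply: IH => //; apply: leq_ltn_trans szc _; rewrite -ltnS -szS.
(* Redirecting the edge from [j] to [y] in [V] keeps the number of edges and drops the vertex
   [j]. *)
have IH2 : padded_span (size s' + 1) (fits s) (fun n m =>
   \sum_(y <- [seq y <- V | y \notin unzip2 s'])
     (-1)%:P.[n%:R] *: ((n - size V)`!%:R^-1 *: extension_sum n ((i, y) :: s') m)).
  apply: padded_span_sum => y; rewrite mem_filter => /andP[y2 yV].
  have h : padded_span (size s').+1 (fits ((i, y) :: s')) (fun n m =>
      (n - size V)`!%:R^-1 *: extension_sum n ((i, y) :: s') m).
    rewrite -(perm_size (supV y yV)); apply: (IH ((i, y) :: s')) => //=.
      by rewrite (perm_size (supV y yV)) -ltnS -szS.
    by rewrite y2.
  have := padded_spanM (j := 0) (size_polyC_leq1 (-1)) h; rewrite addn0 addn1.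
  apply: eq_padded_span => n m fs _; split=> //.
  by apply/allP => v; rewrite (perm_mem (supV y yV)); apply: fitsV.
have {}IH1 : padded_span (size s' + 1) (fits s) (fun n m =>
    q.[n%:R] *: ((n - c)`!%:R^-1 *: extension_sum n s' m)).
  apply: eq_padded_span IH1 => n m fs _; split=> //.
  by apply/allP => v vs; apply: fitsV fs _; rewrite mem_undup inE vs orbT.
rewrite -addn1; apply: eq_padded_span (padded_spanD IH1 IH2) => n m fs _; split=> //.
have sn := size_vertices_le fs; rewrite szS in sn *.
have nz k : k`!%:R != 0 :> C by rewrite Num.Theory.pnatr_eq0 -lt0n fact_gt0.
have nzS k : k.+1%:R != 0 :> C by rewrite Num.Theory.pnatr_eq0.
have fs' : fits s' n.
  by apply/allP => v vs; apply: fitsV fs _; rewrite mem_undup inE vs orbT.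
have hin : (i < n)%N by apply: fitsV fs _; rewrite memV eqxx.
have hjn : (j < n)%N.
  by apply: (allP fs); rewrite mem_vertices (map_f snd ps) orbT.
have := @extension_sum_rec n (Ordinal hin) (Ordinal hjn) s' m fs' hi ji.
rewrite /= -/V mem_vertices negb_or j1 hj' => /(_ isT).
rewrite -(perm_extension_sum n m pe) => rec.
have -> : q.[n%:R] *: ((n - c)`!%:R^-1 *: extension_sum n s' m)
    = (n - size V)`!%:R^-1 *: extension_sum n s' m.
  rewrite scalerA; congr (_ *: _); rewrite /q szV.
  case: (i \in vertices s') szV => szV; first by rewrite hornerC mul1r addn0.
  have cn : (c < n)%N by apply: leq_ltn_trans szc _.
  rewrite hornerXsubC -natrB; last exact: ltnW.
  rewrite addn1 -(subnSK cn).
  by rewrite factS natrM invfM mulrA mulfV ?mul1r.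
rewrite rec scalerDr addrAC scaler_sumr -big_split big1 /=; last first.
  by move=> y _; rewrite hornerC scaleN1r subrr.
rewrite add0r scalerA; congr (_ *: _).
by rewrite -(subnSK sn) factS natrM invfM mulrAC mulVf ?mul1r.
Qed.

End Sums.

(** * Removal of trailing zeros and passage to atomic symmetric functions *)

Definition strip (la : seq nat) : seq nat := [seq a <- la | a != 0%N].

Lemma sumn_strip la : sumn (strip la) = sumn la.
Proof.
elim: la => // a la IH; rewrite /strip /=.
by case: eqP => /= [->|_]; rewrite -/(strip la) IH.
Qed.

Lemma strip_cat la : sorted geq la -> exists j, la = strip la ++ nseq j 0%N.
Proof.
elim: la => [|a la IH] sla; first by exists 0%N.
rewrite /strip /=; case: eqP => [a0|_] /=; last first.
  by have [j {1}->] := IH (path_sorted sla); exists j.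
have tr : transitive geq by move=> x y z /= h1 h2; apply: leq_trans h2 h1.
have la0 : la = nseq (size la) 0%N.
  apply/all_pred1P; apply: sub_all (order_path_min tr sla) => b /=.
  by rewrite a0 leqn0.
have sl : strip la = [::] by rewrite la0 /strip filter_nseq.
by exists (size la).+1; rewrite -/(strip la) sl /= -la0 a0.
Qed.

Lemma is_part_strip la : sorted geq la -> is_part (strip la).
Proof.
move=> sla; rewrite /is_part mem_filter /= andbT.
by apply: sorted_filter sla => x y z /= h1 h2; apply: leq_trans h2 h1.
Qed.

(** The power sum of the cycle type is a class function, so each [v] of the Reynolds average
    contributes the same. *)
Lemma atomicE (C : numFieldType) n k (I J : k.-tuple nat) m :
  atomic C n I J m
  = \sum_(w : 'S_n) pperm_ind C I J w *: power_sum C (cycle_type w) m.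
Proof.
have nz : n`!%:R != 0 :> C by rewrite Num.Theory.pnatr_eq0 -lt0n fact_gt0.
rewrite /atomic /frob_ch scalerA mulfV // scale1r.
transitivity (n`!%:R^-1 *: \sum_(v : 'S_n) \sum_(w : 'S_n)
    pperm_ind C I J w *: power_sum C (cycle_type w) m).
  rewrite scaler_sumr; under [RHS]eq_bigr => v _.
    rewrite (reindex_inj (conjg_inj v)) scaler_sumr; over.
  rewrite exchange_big; apply: eq_bigr => w _.
  rewrite /reynolds -scalerA scaler_suml scaler_sumr; apply: eq_bigr => v _.
  by rewrite power_sum_cycle_type_conj conjgE mulgA.
by rewrite sumr_const card_Sn -scaler_nat scalerA mulVf // scale1r.
Qed.

(** Shifts the labels from 1, ..., n to 0, ..., n-1; positivity makes [predn] reversible. *)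
Lemma pperm_ind_extends (C : fieldType) n k (I J : k.-tuple nat) (w : 'S_n) :
  {in I, forall i, (0 < i)%N} -> {in J, forall j, (0 < j)%N} ->
  pperm_ind C I J w = (extends (zip (map predn I) (map predn J)) w)%:R.
Proof.
move=> Ipos Jpos; congr (_%:R); congr nat_of_bool.
have sz : size (map predn I) = size (map predn J) by rewrite !size_map !size_tuple.
have szs : size (zip (map predn I) (map predn J)) = k.
  by rewrite size_zip !size_map !size_tuple minnn.
have E p : [exists x : 'I_n, (x.+1 == tnth I p) && ((w x).+1 == tnth J p)]
  = (fun q => [exists i : 'I_n, (val i == q.1) && (val (w i) == q.2)])
      (nth (0, 0)%N (zip (map predn I) (map predn J)) p).
  rewrite nth_zip // !(nth_map 0%N) ?size_tuple // -!tnth_nth /=.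
  apply: eq_existsb => x.
  by rewrite -[in LHS](prednK (Ipos _ (mem_tnth p I))) -[in LHS](prednK (Jpos _ (mem_tnth p J))).
apply/forallP/(all_nthP (0, 0)%N) => [h p|h p].
  by rewrite szs => hp; have := h (Ordinal hp); rewrite E.
by rewrite E; apply: h; rewrite szs.
Qed.

Lemma size_vertices_zip k (I J : k.-tuple nat) :
  {in I, forall i, (0 < i)%N} -> {in J, forall j, (0 < j)%N} ->
  size (vertices (zip (map predn I) (map predn J))) = size (undup (I ++ J)).
Proof.
move=> Ipos Jpos.
have predK (s : seq nat) : {in s, forall i, (0 < i)%N} -> s = map succn (map predn s).
  move=> h; rewrite -map_comp -[LHS]map_id; apply/eq_in_map => i /h /=.
  by move/prednK.
rewrite /vertices unzip1_zip ?unzip2_zip ?size_map ?size_tuple //.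
rewrite [in RHS](predK _ Ipos) [in RHS](predK _ Jpos) -[in RHS]map_cat.
by rewrite (undup_map_inj succn_inj) size_map.
Qed.

Theorem theorem6p7 (C : numClosedFieldType) (k : nat) (I J : k.-tuple nat)
    (Ipos : {in I, forall i, (0 < i)%N}) (Jpos : {in J, forall j, (0 < j)%N})
    (Iuniq : uniq I) (Juniq : uniq J) :
  exists c : seq nat -> {poly C},
    (forall la, la \in parts_le k -> (size (c la) <= (k - sumn la).+1)%N) /\
    (forall n : nat,
       (\max_(i <- I) i <= n)%N -> (\max_(j <- J) j <= n)%N -> (2 * k <= n)%N ->
       forall m : nat,
         atomic C n I J m =
         (n - size (undup (I ++ J)))`!%:R *:
           \sum_(la <- parts_le k) (c la).[n%:R] *: schur C (padded la n) m).
Proof.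
pose s := zip (map predn I) (map predn J).
have pred_inj (K : k.-tuple nat) : {in K, forall i, (0 < i)%N} -> {in K &, injective predn}.
  by move=> h a b /h a0 /h b0 e; rewrite -(prednK a0) e prednK.
have z1 : unzip1 s = map predn I by rewrite unzip1_zip // !size_map !size_tuple.
have z2 : unzip2 s = map predn J by rewrite unzip2_zip // !size_map !size_tuple.
have szs : size s = k by rewrite size_zip !size_map !size_tuple minnn.
have u1 : uniq (unzip1 s) by rewrite z1 map_inj_in_uniq //; apply: pred_inj.
have u2 : uniq (unzip2 s) by rewrite z2 map_inj_in_uniq //; apply: pred_inj.
have [l /allP hl e] := @extension_sum_span C s u1 u2; rewrite szs in hl e.
(* Entries of [l] that become equal after the zeros are removed have their coefficients added. *)
exists (fun la => \sum_(t <- l | strip t.2 == la) t.1); split=> [la _|n hI hJ kn m].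
  apply: leq_trans (size_sum _ _ _) _; rewrite big_seq_cond.
  apply: (big_ind (fun x => x <= (k - sumn la).+1)%N) => // [a b ha hb|t /andP[tl /eqP <-]].
    by rewrite geq_max ha.
  by have /and3P[_ _] := hl t tl; rewrite sumn_strip.
have fs : fits s n.
  apply/allP => v; rewrite mem_vertices z1 z2 => /orP[]/mapP[i hi ->].
    by rewrite prednK ?Ipos //; apply: leq_trans hI; apply: leq_bigmax_seq.
  by rewrite prednK ?Jpos //; apply: leq_trans hJ; apply: leq_bigmax_seq.
have nz : (n - size (undup (I ++ J)))`!%:R != 0 :> C.
  by rewrite Num.Theory.pnatr_eq0 -lt0n fact_gt0.
have -> : atomic C n I J m = extension_sum C n s m.
  rewrite atomicE /extension_sum [RHS]big_mkcond; apply: eq_bigr => w _.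
  by rewrite pperm_ind_extends // -/s; case: extends; rewrite ?scale1r ?scale0r.
have := e n m fs kn; rewrite size_vertices_zip // => /(congr1 (fun v =>
  (n - size (undup (I ++ J)))`!%:R *: v)); rewrite scalerA mulfV // scale1r => ->.
congr (_ *: _).
transitivity (\sum_(la <- parts_le k) \sum_(t <- l | strip t.2 == la)
    t.1.[n%:R] *: schur_poly (xvar C m) m (padded t.2 n)).
  rewrite (exchange_big_dep xpredT) //=; apply: eq_big_seq => t /hl/and3P[st kt _].
  rewrite -big_filter (_ : filter _ _ = [:: strip t.2]) ?big_seq1 //.
  rewrite (eq_filter (a2 := pred1 (strip t.2))) => [|la]; last by rewrite /= eq_sym.
  rewrite filter_pred1_uniq ?parts_le_uniq // mem_parts_le.
  by rewrite is_part_strip // sumn_strip.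
apply: eq_big_seq => la; rewrite mem_parts_le => /andP[/andP[sla _] kla].
rewrite horner_sum scaler_suml big_seq_cond [RHS]big_seq_cond.
apply: eq_bigr => t /andP[/hl/and3P[st _ _] /eqP et]; congr (_ *: _).
(* The padded sequence is weakly decreasing because [2 * k <= n] and [sumn la <= k]. *)
rewrite schurE; last first.
  rewrite /padded; case: (la) sla kla => //= a la' -> h; rewrite andbT; lia.
have [j ej] := strip_cat st.
by rewrite /padded -et sumn_strip {2}ej -cat_cons schur_poly_cat0.
Qed.
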